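(* Let $K$ be a field, let $n\ge 1$, $N\geq 1$, $1\le e\le n$ and $u>n$ be integers, and regard $\mathbb{P}^n$ as a linear subvariety of $\mathbb{P}^{n+N}$ (over $K$). Let $S(n,e,u)$ be a star configuration of codimension $e$ in $\mathbb{P}^n$ defined by $u$ hyperplanes of $\mathbb{P}^n$, let $P_1,\ldots,P_N\in\mathbb{P}^{n+N}$ be general points, and let $G\subset\mathbb{P}^{n+N}$ be the reduced scheme-theoretic union of the $N$ points $P_1,\ldots,P_N$ and the $\binom{u}{e}$ linear varieties in $S(n,e,u)$. Let $I_G\subset K[\mathbb{P}^{n+N}]$ be the saturated homogeneous ideal of $G$. Then: \begin{itemize} \item[(a)] $\dfrac{2}{\gamma(I_G)}\leq \rho(I_G)$. \item[(b)] If $K$ has characteristic $0$, then $$\gamma(I_G)=\frac{N(u-e)+u}{N(u-e)+e}.$$ \item[(c)] If $e=n$, then $$\rho(I_G)\leq \frac{u-n+1}{\gamma(I_G)}.$$ \end{itemize}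
   Context: Star configuration: let $A_1,\ldots,A_u\subset\mathbb{P}^n$ be $u>n$ hyperplanes such that the intersection of any $i$ of them has dimension at most $n-i$ (so the intersection is empty when $i>n$). The star configuration $S(n,e,u)$ of codimension $e\le n$ is the set of the $\binom{u}{e}$ linear varieties $A_{i_1}\cap\cdots\cap A_{i_e}$ with $i_1,\ldots,i_e$ distinct. General points: as usual, ''for general points $P_1,\ldots,P_N$'' means for all $(P_1,\ldots,P_N)$ in some nonempty Zariski-open subset of $(\mathbb{P}^{n+N})^N$ (which may depend on the star configuration and on the embedding $\mathbb{P}^n\subset\mathbb{P}^{n+N}$). Ideals: $K[\mathbb{P}^{n+N}]=K[x_0,\ldots,x_{n+N}]$. For a linear subvariety $V$, $I_V$ is the ideal generated by all forms vanishing on $V$. Then $I_G=\bigcap_V I_V$, where $V$ runs over $P_1,\ldots,P_N$ and the elements of $S(n,e,u)$, and for $m\ge1$ the symbolic power is $I_G^{(m)}=\bigcap_V I_V^m$. For a nonzero homogeneous ideal $I$, $\alpha(I)$ is the least degree $t$ such that $I$ contains a nonzero form of degree $t$. The Waldschmidt constant is $\gamma(I)=\lim_{m\to\infty}\alpha(I^{(m)})/m$ (this limit exists). The resurgence of $(0)\ne I\subsetneq K[\mathbb{P}^{n+N}]$ is $\rho(I)=\sup\{m/r : m,r\ge 1,\ I^{(m)}\not\subseteq I^r\}$. *)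

(* Defs.v *)
From HB Require Import structures.
From mathcomp Require Import all_boot all_order all_algebra.
(* mpoly must be imported before the analysis files: the opposite order makes
   their notation levels clash. *)
From mathcomp Require Import mpoly.
From mathcomp Require Import boolp classical_sets reals ereal topology
  normedtype sequences.

Set Implicit Arguments.
Unset Strict Implicit.
Unset Printing Implicit Defensive.

Import Order.TTheory GRing.Theory Num.Theory.
Import numFieldNormedType.Exports.

Local Open Scope ring_scope.

Section Ideals.
Variable A : comNzRingType.

Definition ideal_gen (S : A -> Prop) : A -> Prop := fun f =>
  exists (k : nat) (a s : 'I_k -> A),
    (forall i, S (s i)) /\ f = \sum_(i < k) a i * s i.

Definition ideal_pow (I : A -> Prop) (r : nat) : A -> Prop :=
  ideal_gen (fun f =>
    exists g : 'I_r -> A, (forall i, I (g i)) /\ f = \prod_(i < r) g i).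

End Ideals.

(* The projective space P^(d-1) over K has coordinate ring {mpoly K[d]}.  Its
   points are nonzero row vectors up to scaling, and its linear subvarieties are
   the subspaces V of 'rV[K]_d, of projective dimension \dim V - 1. *)

Section LinearVarieties.
Variables (K : fieldType) (d : nat).
Implicit Types (V W : {vspace 'rV[K]_d}) (f : {mpoly K[d]}).

(* The points of V with values in every extension field are tested: over a
   finite field K, forms outside the ideal of the variety V vanish at all of its
   K-rational points. *)
Definition vanishes_on V f : Prop :=
  forall (L : fieldType) (phi : {rmorphism K -> L}) (v : 'rV[L]_d),
    v != 0 -> v \in <<[seq map_mx phi w | w <- vbasis V]>>%VS ->
    mmap phi (fun i => v 0 i) f = 0.

Definition linear_ideal V : {mpoly K[d]} -> Prop :=
  ideal_gen (fun f => (exists t : nat, f \is t.-homog) /\ vanishes_on V f).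

(* Here n is the projective dimension of the ambient space W of the hyperplanes
   H j.  The intersection of i of them has vector space dimension at most
   n + 1 - i, where the truncated subtraction gives the empty intersection for
   i > n. *)
Definition star_hyperplanes (n u : nat) W (H : 'I_u -> {vspace 'rV[K]_d}) :
    Prop :=
  (forall j, (H j <= W)%VS /\ \dim (H j) = n) /\
  (forall J : {set 'I_u}, J != finset.set0 ->
     (\dim (\bigcap_(j in J) H j)%VS <= n.+1 - #|J|)%N).

Definition star_configuration (u e : nat) (H : 'I_u -> {vspace 'rV[K]_d}) :
    {vspace 'rV[K]_d} -> Prop := fun V =>
  exists J : {set 'I_u}, #|J| = e /\ V = (\bigcap_(j in J) H j)%VS.

(* A family G of linear varieties stands for its reduced union. *)

Definition union_ideal (G : {vspace 'rV[K]_d} -> Prop) : {mpoly K[d]} -> Prop :=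
  fun f => forall V, G V -> linear_ideal V f.

Definition symbolic_power (G : {vspace 'rV[K]_d} -> Prop) (m : nat) :
    {mpoly K[d]} -> Prop :=
  fun f => forall V, G V -> ideal_pow (linear_ideal V) m f.

Definition has_form_of_degree (I : {mpoly K[d]} -> Prop) (t : nat) : Prop :=
  exists f, [/\ I f, f != 0 & f \is t.-homog].

Definition alpha (I : {mpoly K[d]} -> Prop) : nat :=
  xget 0%N (fun t => has_form_of_degree I t /\
    forall s, has_form_of_degree I s -> (t <= s)%N).

Definition waldschmidt (R : realType) (G : {vspace 'rV[K]_d} -> Prop) : R :=
  lim ((fun m : nat => (alpha (symbolic_power G m))%:R / m%:R : R)
         @ \oo)%classic.

Definition resurgence (R : realType) (G : {vspace 'rV[K]_d} -> Prop) : \bar R :=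
  ereal_sup (fun x : \bar R => exists m r : nat,
    [/\ (1 <= m)%N, (1 <= r)%N,
        ~ (forall f, symbolic_power G m f -> ideal_pow (union_ideal G) r f)
      & x = (m%:R / r%:R)%:E]).

End LinearVarieties.

Section GeneralPoints.
Variables (K : fieldType) (N d : nat).

(* Row i of P holds homogeneous coordinates of the i-th of N points. *)
Definition point_tuple (P : 'M[K]_(N, d)) : Prop := forall i, row i P != 0.

(* Coordinate j of point i is the variable with index mxvec_index i j. *)
Definition multihomogeneous (F : {mpoly K[N * d]}) : Prop :=
  exists deg : 'I_N -> nat, forall m, m \in msupp F ->
    forall i, (\sum_(j < d) m (mxvec_index i j))%N = deg i.

Definition eval_tuple (F : {mpoly K[N * d]}) (P : 'M[K]_(N, d)) : K :=
  F.@[fun k => mxvec P 0 k].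

Definition zariski_open (U : 'M[K]_(N, d) -> Prop) : Prop :=
  exists S : {mpoly K[N * d]} -> Prop,
    (forall F, S F -> multihomogeneous F) /\
    (forall P, point_tuple P -> (U P <-> exists F, S F /\ eval_tuple F P != 0)).

Definition for_general_points (Q : 'M[K]_(N, d) -> Prop) : Prop :=
  exists U : 'M[K]_(N, d) -> Prop,
    [/\ zariski_open U, (exists P, point_tuple P /\ U P)
      & forall P, point_tuple P -> U P -> Q P].

End GeneralPoints.

Definition points_and_star (K : fieldType) (N d u e : nat)
    (P : 'M[K]_(N, d)) (H : 'I_u -> {vspace 'rV[K]_d}) :
    {vspace 'rV[K]_d} -> Prop := fun V =>
  (exists i, V = <[row i P]>%VS) \/ star_configuration e H V.

(* Main.v *)
Require Import Defs.
From HB Require Import structures.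
From mathcomp Require Import all_boot all_order all_algebra.
From mathcomp Require Import mpoly.
From mathcomp Require Import boolp classical_sets reals ereal topology
  normedtype sequences.
From mathcomp Require Import fintype finset perm zify ring lra.

(* Let y_i be the linear form which vanishes on W and on all the points but the
   i-th, and let l_j be the one which vanishes on the points and cuts out H_j
   in W.  A monomial in the y_i and l_j lies in the m-th symbolic power if and
   only if its total degree in the y's and in the l_j, j in J, is at least m
   for every J of size e, and its degree without y_i is at least m for every i.
   These monomials span the symbolic power: restrict to a hyperplane l_j = 0,
   lift the monomials found there, subtract, divide by l_j and repeat.

   The Waldschmidt constant is then the optimum of a linear program, in any
   characteristic, and alpha (I_G) >= 2 gives (a).  For (c), put w = u - n + 1;
   a monomial of degree at least r w in I_G^(r) lies in I_G^r because, after
   rewriting some l_j in terms of n + 1 others, it is divisible by a product of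
   r monomials of the forms y_i y_k, y_i l_j, and products of w distinct l_j,
   all of which are in I_G. *)

Set Implicit Arguments.
Unset Strict Implicit.
Unset Printing Implicit Defensive.

Import Order.TTheory GRing.Theory Num.Theory.
Import numFieldNormedType.Exports.

Local Open Scope ring_scope.

(** When u > n + 1 the l_j are linearly dependent, so a polynomial has many expansions into
    monomials, and its order along a star component cannot be read off from an arbitrary one, since
    terms may cancel. An expansion with the right orders along the star has to be constructed. For a
    point P_i any expansion will do: scaling all forms but y_i is a ring map, so the terms of too
    small order at P_i add up to zero. Hence the star is treated before the points, which merely
    delete terms.

    Membership in a power of I_V is exploited only through the order of vanishing along lines v + t
    x with values in arbitrary domains over K. Division by a linear form then becomes cancellation
    in a polynomial ring over a domain, and a finite K needs no separate treatment. Independence of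
    forms enters only through dual vectors, which exist for the y's together with any n + 1 of the
    l_j. *)

(** * Evaluation of polynomials and the generic point *)

Section Evaluation.
Variables (K : fieldType) (d : nat).
Implicit Types (f : {mpoly K[d]}).

Definition evalv (S : nzRingType) (phi : K -> S) (v : 'rV[S]_d) f : S :=
  mmap phi (fun i => v 0 i) f.

Definition linform (a : 'cV[K]_d) : {mpoly K[d]} := \sum_i a i 0 *: 'X_i.

Lemma eq_evalv (S : nzRingType) (phi psi : K -> S) v f :
  phi =1 psi -> evalv phi v f = evalv psi v f.
Proof. by move=> e; apply: eq_bigr => m _; rewrite e. Qed.

Lemma evalv_linform (S : comNzRingType) (phi : {rmorphism K -> S}) v a :
  evalv phi v (linform a) = (v *m map_mx phi a) 0 0.
Proof.
rewrite /evalv /linform raddf_sum mxE; apply: eq_bigr => i _ /=.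
by rewrite mmapZ mmapX mmap1U mxE mulrC.
Qed.

Lemma evalv_rmorph (S T : nzRingType) (h : {rmorphism S -> T}) (phi : K -> S)
    (v : 'rV_d) f :
  h (evalv phi v f) = evalv (h \o phi) (map_mx h v) f.
Proof.
rewrite /evalv /mmap rmorph_sum; apply: eq_bigr => m _.
rewrite rmorphM /mmap1 rmorph_prod; congr (_ * _).
by apply: eq_bigr => i _; rewrite rmorphXn mxE.
Qed.

(** Evaluation at this point gives the polynomial back, so that statements tested at all points
    become polynomial identities. *)
Definition generic_point : 'rV[{mpoly K[d]}]_d := \row_i 'X_i.

Lemma evalv_generic f : evalv (@mpolyC d K) generic_point f = f.
Proof.
rewrite [RHS]mpolyE; apply: eq_bigr => m _.
rewrite mul_mpolyC [in RHS]mpolyXE_id; congr (_ *: _).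
by apply: eq_bigr => i _; rewrite mxE.
Qed.

Lemma evalvD (S : comNzRingType) (phi : {rmorphism K -> S}) v f g :
  evalv phi v (f + g) = evalv phi v f + evalv phi v g.
Proof. exact: raddfD. Qed.

Lemma evalvB (S : comNzRingType) (phi : {rmorphism K -> S}) v f g :
  evalv phi v (f - g) = evalv phi v f - evalv phi v g.
Proof. exact: raddfB. Qed.

Lemma evalvM (S : comNzRingType) (phi : {rmorphism K -> S}) v f g :
  evalv phi v (f * g) = evalv phi v f * evalv phi v g.
Proof. exact: rmorphM. Qed.

Lemma evalv0 (S : comNzRingType) (phi : {rmorphism K -> S}) v :
  evalv phi v (0 : {mpoly K[d]}) = 0.
Proof. exact: raddf0. Qed.

Lemma evalv_comp (S : comNzRingType) (phi : {rmorphism K -> S}) (v : 'rV[S]_d)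
    (p : 'rV[{mpoly K[d]}]_d) f :
  evalv phi v (evalv (@mpolyC d K) p f) = evalv phi (map_mx (evalv phi v) p) f.
Proof.
rewrite {1}/evalv (evalv_rmorph (mmap phi (fun i => v 0 i))).
by apply: eq_evalv => c /=; rewrite mmapC.
Qed.

(** Serves to compare a polynomial at the generic point and at its projection to a hyperplane, with
    [a] the equation of the hyperplane. *)
Lemma evalv_cong (S : comNzRingType) (phi : K -> S) (v w : 'rV[S]_d) (a : S) f :
  (forall i, exists g, v 0 i = w 0 i + a * g) ->
  exists g, evalv phi v f = evalv phi w f + a * g.
Proof.
move=> vw; rewrite /evalv /mmap.
have add0 : exists g : S, 0 = 0 + a * g by exists 0; rewrite mulr0 addr0.
apply: (big_ind2 (fun x y => exists g, x = y + a * g)) => //.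
  move=> _ y1 _ y2 [g1 ->] [g2 ->]; exists (g1 + g2).
  by rewrite mulrDr addrACA.
have mulP x1 y1 x2 y2 : (exists g, x1 = y1 + a * g) ->
    (exists g, x2 = y2 + a * g) -> exists g, x1 * x2 = y1 * y2 + a * g.
  move=> [g1 ->] [g2 ->]; exists (y1 * g2 + g1 * y2 + g1 * (a * g2)).
  by rewrite mulrDl !mulrDr !addrA !mulrA (mulrC a y1).
have refl x : exists g, x = x + a * g by exists 0; rewrite mulr0 addr0.
move=> m _; apply: (mulP); first exact: (refl).
rewrite /mmap1; apply: (big_ind2 (fun x y => exists g, x = y + a * g)) => //.
move=> i _; elim: (m i) => [|k IH]; first by rewrite !expr0.
by rewrite !exprS; apply: (mulP).
Qed.

End Evaluation.

(** * Order of vanishing along linear spaces, and division by linear forms *)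

Section Order.
Variables (K : fieldType) (d : nat) (I : finType) (F : I -> 'cV[K]_d).
Implicit Types (f g : {mpoly K[d]}) (B C D : {set I}).

Local Notation lin b := (linform (F b)).

Definition zeros (S : nzRingType) (phi : K -> S) B (v : 'rV[S]_d) : Prop :=
  forall b, b \in B -> evalv phi v (lin b) = 0.

(** Equality on the linear space B = 0. Points over all domains are tested, the generic point among
    them when B is empty. *)
Definition eqmod B f g : Prop :=
  forall (S : idomainType) (phi : {rmorphism K -> S}) (v : 'rV[S]_d),
    zeros phi B v -> evalv phi v f = evalv phi v g.

(* On the linear space C = 0, the polynomial f vanishes to order q along the
   subspace B = 0. *)
Definition ordge B C q f : Prop :=
  forall (S : idomainType) (phi : {rmorphism K -> S}) (v x : 'rV[S]_d),
    zeros phi B v -> zeros phi C x ->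
    exists g : {poly S},
      evalv (polyC \o phi) (map_mx polyC v + 'X *: map_mx polyC x) f = 'X^q * g.

Lemma zerosW (S : nzRingType) (phi : K -> S) B C v :
  B \subset C -> zeros phi C v -> zeros phi B v.
Proof. by move=> /subsetP BC Cv b /BC; apply: Cv. Qed.

Lemma evalv_linD (S : comNzRingType) (phi : {rmorphism K -> S}) v w a b :
  evalv phi (v + a *: w) (lin b) =
  evalv phi v (lin b) + a * evalv phi w (lin b).
Proof.
by rewrite !evalv_linform mulmxDl -scalemxAl [LHS]mxE [X in _ + X]mxE.
Qed.

Lemma zeros_comb (S : comNzRingType) (phi : {rmorphism K -> S}) B v w a :
  zeros phi B v -> zeros phi B w -> zeros phi B (v + a *: w).
Proof.
by move=> Bv Bw b bB; rewrite evalv_linD Bv // Bw // mulr0 addr0.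
Qed.

Lemma zeros_map (S T : comNzRingType) (h : {rmorphism S -> T})
    (phi : {rmorphism K -> S}) B v :
  zeros phi B v -> zeros (h \o phi) B (map_mx h v).
Proof. by move=> Bv b bB; rewrite -evalv_rmorph Bv // rmorph0. Qed.

Lemma ordgeW B C D q f : C \subset D -> ordge B C q f -> ordge B D q f.
Proof. by move=> CD Bf S phi v x Bv /(zerosW CD); apply: Bf. Qed.

Lemma ordge_le B C q r f : (q <= r)%N -> ordge B C r f -> ordge B C q f.
Proof.
move=> qr Bf S phi v x Bv Cx; have [g ->] := Bf S phi v x Bv Cx.
by exists ('X^(r - q) * g); rewrite mulrA -exprD subnKC.
Qed.

Lemma ordge0 B C f : ordge B C 0 f.
Proof.
move=> S phi v x _ _; rewrite expr0; eexists; rewrite mul1r; reflexivity.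
Qed.

(** As C is contained in B, the whole line v + t x lies in the space C = 0, where f and g agree. *)
Lemma ordge_eqmod B C q f g :
  C \subset B -> eqmod C f g -> ordge B C q f -> ordge B C q g.
Proof.
move=> CB fg Bf S phi v x Bv Cx; have [p fE] := Bf S phi v x Bv Cx.
exists p; rewrite -fE; apply/esym/(fg {poly S} (polyC \o phi)).
by apply: zeros_comb; apply: zeros_map => //; apply: zerosW Bv.
Qed.

Lemma ordgeD B C q f g : ordge B C q f -> ordge B C q g -> ordge B C q (f + g).
Proof.
move=> Bf Bg S phi v x Bv Cx.
have [p fE] := Bf S phi v x Bv Cx; have [r gE] := Bg S phi v x Bv Cx.
by exists (p + r); rewrite mulrDr -fE -gE /evalv raddfD.
Qed.

Lemma ordgeM B C q r f g :
  ordge B C q f -> ordge B C r g -> ordge B C (q + r) (f * g).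
Proof.
move=> Bf Bg S phi v x Bv Cx.
have [p fE] := Bf S phi v x Bv Cx; have [s gE] := Bg S phi v x Bv Cx.
by exists (p * s); rewrite exprD mulrACA -fE -gE evalvM.
Qed.

Lemma ordgeZ B C q a f : ordge B C q f -> ordge B C q (a *: f).
Proof.
by move=> Bf; rewrite -mul_mpolyC -[q]add0n; apply: ordgeM => //; apply: ordge0.
Qed.

Lemma ordge_lin B C b : b \in B -> ordge B C 1 (lin b).
Proof.
move=> bB S phi v x Bv Cx.
exists (evalv (polyC \o phi) (map_mx polyC x) (lin b)).
by rewrite evalv_linD (zeros_map polyC Bv) // add0r expr1.
Qed.

Lemma ordge_sum B C q (T : eqType) (r : seq T) (G : T -> {mpoly K[d]}) :
  (forall t, t \in r -> ordge B C q (G t)) -> ordge B C q (\sum_(t <- r) G t).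
Proof.
elim: r => [|t r IH] rG.
  by rewrite big_nil => S phi v x _ _; exists 0; rewrite mulr0 evalv0.
rewrite big_cons; apply: ordgeD; first by apply: rG; rewrite mem_head.
by apply: IH => s sr; apply: rG; rewrite in_cons sr orbT.
Qed.

Lemma Xn_dvd_coprime (S : idomainType) q (c p g : {poly S}) :
  c`_0 != 0 -> c * p = 'X^q * g -> exists h, p = 'X^q * h.
Proof.
move=> c0; elim: q p => [|q IH] p cp; first by exists p; rewrite expr0 mul1r.
have p0 : p`_0 = 0.
  have /eqP := congr1 (fun r : {poly S} => r`_0) cp.
  by rewrite coef0M exprS -mulrA coefXM mulf_eq0 (negPf c0) => /eqP.
have [r pE] : exists r, p = 'X * r.
  have /factor_theorem[r ->] : root p 0 by rewrite rootE horner_coef0 p0.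
  by exists r; rewrite subr0 mulrC.
have [|h rE] := IH r; last by exists h; rewrite pE rE exprS mulrA.
apply: (mulfI (negbT (polyX_eq0 S))); rewrite mulrCA -pE cp.
by rewrite exprS mulrA.
Qed.

(* A witness over the parameter ring S[t], where a linear form which does not
   vanish identically on the linear space can be made nonzero. *)
Lemma ordge_deform q g (S : idomainType) (phi : {rmorphism K -> S})
    (v x : 'rV[S]_d) (v' x' : 'rV[{poly S}]_d) :
  v = map_mx (horner_eval 0) v' -> x = map_mx (horner_eval 0) x' ->
  (exists h : {poly {poly S}},
     evalv (polyC \o (polyC \o phi))
       (map_mx polyC v' + 'X *: map_mx polyC x') g = 'X^q * h) ->
  exists h : {poly S},
    evalv (polyC \o phi) (map_mx polyC v + 'X *: map_mx polyC x) g = 'X^q * h.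
Proof.
move=> -> -> [h gE]; exists (map_poly (horner_eval 0) h).
rewrite -(map_polyXn (horner_eval 0 : {rmorphism {poly S} -> S})) -rmorphM -gE.
rewrite evalv_rmorph; set p := (X in evalv _ X).
set p' := (X in _ = evalv _ X _).
have -> : p = p'.
  apply/rowP => i.
  by rewrite !mxE /= rmorphD rmorphM /= map_polyX !map_polyC.
by apply: eq_evalv => c /=; rewrite map_polyC /= /horner_eval hornerC.
Qed.

Lemma row_deform (S : idomainType) (v : 'rV[S]_d) (w : 'rV[{poly S}]_d) :
  v = map_mx (horner_eval 0) (map_mx polyC v + 'X *: w).
Proof.
by apply/rowP => i; rewrite !mxE /horner_eval !hornerE ?(mul0r, mulr0) ?addr0.
Qed.

Definition dual_vector B b (w : 'rV[K]_d) : Prop :=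
  w *m F b = 1%:M /\ forall b', b' \in B -> b' != b -> w *m F b' = 0.

Lemma zeros_dual (S : comNzRingType) (phi : {rmorphism K -> S}) B C b w :
  dual_vector B b w -> C \subset B -> b \notin C -> zeros phi C (map_mx phi w).
Proof.
move=> [_ w0] /subsetP CB bC c cC; rewrite evalv_linform -map_mxM w0 ?CB //.
  by rewrite map_mx0 mxE.
by apply: contraNneq bC => <-.
Qed.

Lemma lin_dual (S : comNzRingType) (phi : {rmorphism K -> S}) B b w :
  dual_vector B b w -> evalv phi (map_mx phi w) (lin b) = 1.
Proof. by move=> [w1 _]; rewrite evalv_linform -map_mxM w1 map_mx1 mxE. Qed.

(** On the line v + t x the form equals t times its value at x. This value may be zero, so x is
    first moved by a new parameter times w; the value is cancelled over the ring with the parameter,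
    which is then set to 0. *)
Lemma ordge_colon_in B C b w q g :
  C \subset B -> b \in B -> b \notin C -> dual_vector (b |: C) b w ->
  ordge B C q.+1 (lin b * g) -> ordge B C q g.
Proof.
move=> CB bB bC wP Bf S phi v x Bv Cx.
pose phi' : {rmorphism K -> {poly S}} := polyC \o phi.
pose x' := map_mx polyC x + 'X *: map_mx phi' w.
have Cx' : zeros phi' C x'.
  apply: zeros_comb; first exact: zeros_map.
  by apply: zeros_dual wP _ bC; apply: subsetUr.
have Bv' : zeros phi' B (map_mx polyC v) by apply: zeros_map.
apply: (@ordge_deform _ _ _ phi v x (map_mx polyC v) x').
- by apply/rowP => i; rewrite !mxE /horner_eval hornerC.
- exact: row_deform.
have [p fE] := Bf _ phi' _ _ Bv' Cx'.
have x'b : evalv phi' x' (lin b) != 0.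
  rewrite /x' evalv_linD -evalv_rmorph (lin_dual _ wP) mulr1.
  by rewrite addrC -size_poly_eq0 size_XaddC.
move: fE; rewrite evalvM evalv_linD (zeros_map polyC Bv') // add0r.
rewrite -(evalv_rmorph polyC).
rewrite exprS -!mulrA => /(mulfI (negbT (polyX_eq0 _))); apply: Xn_dvd_coprime.
by rewrite coefC.
Qed.

(** Here v is moved instead of x, so that the form has a nonzero constant term on the line and is
    coprime to t. *)
Lemma ordge_colon_out B C b w q g :
  b \notin B -> dual_vector (b |: B) b w ->
  ordge B C q (lin b * g) -> ordge B C q g.
Proof.
move=> bB wP Bf S phi v x Bv Cx.
pose phi' : {rmorphism K -> {poly S}} := polyC \o phi.
pose v' := map_mx polyC v + 'X *: map_mx phi' w.
have Cx' : zeros phi' C (map_mx polyC x) by apply: zeros_map.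
have Bv' : zeros phi' B v'.
  apply: zeros_comb; first exact: zeros_map.
  by apply: zeros_dual wP _ bB; apply: subsetUr.
apply: (@ordge_deform _ _ _ phi v x v' (map_mx polyC x)).
- exact: row_deform.
- by apply/rowP => i; rewrite !mxE /horner_eval hornerC.
have [p fE] := Bf _ phi' _ _ Bv' Cx'.
have v'b : evalv phi' v' (lin b) != 0.
  rewrite /v' evalv_linD -evalv_rmorph (lin_dual _ wP) mulr1.
  by rewrite addrC -size_poly_eq0 size_XaddC.
move: fE; rewrite evalvM evalv_linD -(evalv_rmorph polyC phi' v').
apply: Xn_dvd_coprime.
by rewrite coefD coefC coefXM addr0.
Qed.

(** Take x = v and put t = 0 on the line v + t x. *)
Lemma ordge_same B q f : ordge B B q.+1 f -> eqmod B f 0.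
Proof.
move=> Bf S phi v Bv; have [g fE] := Bf S phi v v Bv Bv.
have := congr1 (horner_eval 0) fE; rewrite evalv_rmorph /=.
rewrite exprS -mulrA [X in _ = X -> _]/horner_eval hornerM hornerX mul0r.
rewrite evalv0 => <-.
rewrite [in LHS](row_deform v (map_mx polyC v)); apply: eq_evalv => c /=.
by rewrite /horner_eval hornerC.
Qed.

(** Projecting the generic point along w to the hyperplane of b changes f by a multiple of the form;
    where the forms in B vanish, f is zero at the projected point. *)
Lemma eqmod_divide B b w f :
  dual_vector (b |: B) b w -> b \notin B ->
  eqmod (b |: B) f 0 -> exists g, eqmod B f (lin b * g).
Proof.
move=> wP bB f0.
pose p : 'rV[{mpoly K[d]}]_d :=
  generic_point K d + (- lin b) *: map_mx (@mpolyC d K) w.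
have [g fE] : exists g, f = evalv (@mpolyC d K) p f + lin b * g.
  rewrite -{1}[f]evalv_generic; apply: evalv_cong => i.
  by exists (w 0 i)%:MP; rewrite !mxE mulNr addrNK.
exists g => S phi v Bv; rewrite fE evalvD.
rewrite evalv_comp [X in X + _](_ : _ = 0) ?add0r //.
pose q := v + (- evalv phi v (lin b)) *: map_mx phi w.
have -> : map_mx (evalv phi v) p = q.
  apply/rowP => i; rewrite !mxE /evalv rmorphD rmorphM rmorphN /= mmapC.
  by rewrite mmapX mmap1U.
have q0 : zeros phi (b |: B) q.
  move=> c; rewrite in_setU1 => /orP[/eqP->|cB].
    by rewrite evalv_linD (lin_dual _ wP) mulr1 subrr.
  have Bw : zeros phi B (map_mx phi w).
    by apply: zeros_dual wP _ bB; apply: subsetUr.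
    by rewrite evalv_linD (Bv c) // (Bw c) // mulr0 addr0.
by rewrite (f0 S phi q q0) evalv0.
Qed.

Lemma eqmod_set0 f g : eqmod set0 f g -> f = g.
Proof.
move=> /(_ {mpoly K[d]} (@mpolyC d K) (generic_point K d)).
by rewrite !evalv_generic; apply=> b; rewrite inE.
Qed.

End Order.

(** * Spans of monomials in a family of linear forms *)

Section Monomials.
Variables (K : fieldType) (d : nat) (I : finType) (F : I -> 'cV[K]_d).
Implicit Types (f g : {mpoly K[d]}) (B C D J : {set I}) (c : {ffun I -> nat}).

Local Notation lin b := (linform (F b)).

Definition fmon c : {mpoly K[d]} := \prod_b lin b ^+ c b.

(** The monomials may be dependent, so P is a condition on the exponents of one suitable expansion
    of f. *)
Definition mspan (P : {ffun I -> nat} -> Prop) f : Prop :=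
  exists2 r : seq (K * {ffun I -> nat}),
    (forall x, x \in r -> P x.2) & f = \sum_(x <- r) x.1 *: fmon x.2.

Definition incr b c : {ffun I -> nat} := [ffun b' => (c b' + (b' == b))%N].

Lemma fmon_incr b c : fmon (incr b c) = lin b * fmon c.
Proof.
rewrite /fmon (bigD1 b) //= [in RHS](bigD1 b) //= mulrA ffunE eqxx addn1 exprS.
by congr (_ * _); apply: eq_bigr => i /negPf ib; rewrite ffunE ib addn0.
Qed.

Lemma sum_incr b c J :
  (\sum_(j in J) incr b c j = (\sum_(j in J) c j) + (b \in J))%N.
Proof.
under eq_bigr do rewrite ffunE.
rewrite big_split /=; congr addn.
case: (boolP (b \in J)) => bJ.
  rewrite (bigD1 b) //= eqxx big1 ?addn0 // => i /andP[_ /negPf->] //.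
by rewrite big1 // => i iJ; case: eqP => // ib; rewrite -ib iJ in bJ.
Qed.

Lemma mspan0 P : mspan P 0.
Proof. by exists [::] => //; rewrite big_nil. Qed.

Lemma mspanD P f g : mspan P f -> mspan P g -> mspan P (f + g).
Proof.
move=> [r rP ->] [s sP ->]; exists (r ++ s); last by rewrite big_cat.
by move=> x; rewrite mem_cat => /orP[/rP|/sP].
Qed.

Lemma mspan_fmon P c : P c -> mspan P (fmon c).
Proof.
move=> Pc; exists [:: (1, c)]; last by rewrite big_seq1 scale1r.
by move=> x; rewrite inE => /eqP->.
Qed.

Lemma mspan_map P Q f (h : {mpoly K[d]} -> {mpoly K[d]}) :
  {morph h : x y / x + y} -> h 0 = 0 ->
  (forall a c, P c -> mspan Q (h (a *: fmon c))) ->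
  mspan P f -> mspan Q (h f).
Proof.
move=> hD h0 hP [r rP ->]; elim: r rP => [|x r IH] rP.
  by rewrite big_nil h0; apply: mspan0.
rewrite big_cons hD; apply: mspanD; first by apply/hP/rP; rewrite mem_head.
by apply: IH => y yr; apply: rP; rewrite in_cons yr orbT.
Qed.

Lemma mspanZ P a f : mspan P f -> mspan P (a *: f).
Proof.
apply: (mspan_map (h := fun x => a *: x)); rewrite ?scaler0 //.
  by move=> x y; rewrite scalerDr.
move=> b c Pc; exists [:: (a * b, c)]; last by rewrite big_seq1 scalerA.
by move=> x; rewrite inE => /eqP->.
Qed.

Lemma mspanW P Q f : (forall c, P c -> Q c) -> mspan P f -> mspan Q f.
Proof. by move=> PQ [r rP ->]; exists r => // x /rP/PQ. Qed.

Lemma mspan_lin P Q b f :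
  (forall c, P c -> Q (incr b c)) -> mspan P f -> mspan Q (lin b * f).
Proof.
move=> PQ; apply: (mspan_map (h := fun x => lin b * x)); rewrite ?mulr0 //.
  by move=> x y; rewrite mulrDr.
move=> a c Pc; rewrite -scalerAr; apply/mspanZ.
by rewrite -fmon_incr; apply/mspan_fmon/PQ.
Qed.

Lemma mspan_total :
  (forall i : 'I_d, exists k : I -> K, 'X_i = \sum_b k b *: lin b) ->
  forall f, mspan xpredT f.
Proof.
move=> gen f.
have mulX i g : mspan xpredT g -> mspan xpredT ('X_i * g).
  have [k ->] := gen i; rewrite mulr_suml => gP.
  elim/big_rec: _ => [|b x _ xP]; first exact: mspan0.
  apply: mspanD => //; rewrite -scalerAl; apply: mspanZ.
  exact: mspan_lin gP.
rewrite [f]mpolyE; elim/big_rec: _ => [|m x _ xP]; first exact: mspan0.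
apply: mspanD => //; apply: mspanZ; rewrite mpolyXE_id.
elim/big_rec: _ => [|i y _ yP].
  have -> : 1 = fmon [ffun=> 0%N].
    by rewrite /fmon big1 // => b _; rewrite ffunE expr0.
  exact: mspan_fmon.
elim: (m i) => [|k IH]; first by rewrite expr0 mul1r.
by rewrite exprS -mulrA; apply: mulX.
Qed.

Lemma fmon_homog c : fmon c \is (\sum_b c b)%N.-homog.
Proof.
rewrite /fmon; elim/big_rec2: _ => [|b k p _ pP]; first exact: dhomog1.
apply: dhomogM => //.
have lin1 : lin b \is 1.-homog.
  apply: rpred_sum => i _; apply: rpredZ.
  by rewrite dhomogX /= mdeg1.
by have := dhomogMn (c b) lin1; rewrite mul1n.
Qed.

(** The part of degree t of the expansion is f itself, which is nonzero. This reduces lower bounds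
    for degrees of forms to monomials. *)
Lemma mspan_homog_ne0 P f t :
  mspan P f -> f \is t.-homog -> f != 0 ->
  exists2 c, P c & (\sum_b c b)%N = t.
Proof.
move=> [r rP fE] ft f0.
have [/hasP[x xr /eqP xt]|/hasPn none] :=
    boolP (has (fun x : K * {ffun I -> nat} => (\sum_b x.2 b)%N == t) r).
  by exists x.2 => //; apply: rP.
case/eqP: f0; rewrite -(pihomog_dE ft) fE linear_sum big1_seq //=.
move=> x xr.
by rewrite linearZ /= (pihomog_ne0 (none x xr) (fmon_homog _)) scaler0.
Qed.

Lemma ordge_fmon B C c : ordge F B C (\sum_(b in B) c b)%N (fmon c).
Proof.
rewrite /fmon [X in ordge _ _ _ _ X](bigID (mem B)) /= -[X in ordge _ _ _ X _]addn0.
apply: ordgeM; last exact: ordge0.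
elim/big_rec2: _ => [|b k p bB pP]; first exact: ordge0.
apply: ordgeM pP; elim: (c b) => [|m IH]; first exact: ordge0.
by rewrite exprS -add1n; apply: ordgeM => //; apply: ordge_lin.
Qed.

Lemma ordge_mspan B C q P f :
  (forall c, P c -> (q <= \sum_(b in B) c b)%N) -> mspan P f ->
  ordge F B C q f.
Proof.
move=> Pq [r rP ->]; apply: ordge_sum => x /rP/Pq qx.
by apply: ordgeZ; apply: ordge_le qx _; apply: ordge_fmon.
Qed.

Lemma ordgeB B C q f g :
  ordge F B C q f -> ordge F B C q g -> ordge F B C q (f - g).
Proof. by move=> ? ?; rewrite -scaleN1r; apply/ordgeD/ordgeZ. Qed.

Lemma eqmod_sub0 B f g : eqmod F B f g -> eqmod F B (f - g) 0.
Proof.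
by move=> fg S phi v Bv; rewrite evalv0 evalvB (fg _ _ _ Bv) subrr.
Qed.

(** One round of restriction and division: g1 is the expansion found on the hyperplane, g the
    quotient of the remainder, and g' the expansion to be found for g. *)
Lemma eqmod_lift C b w f g1 :
  dual_vector F (b |: C) b w -> b \notin C -> eqmod F (b |: C) f g1 ->
  exists2 g, eqmod F C (f - g1) (lin b * g) &
    forall g', eqmod F C g g' -> eqmod F C f (g1 + lin b * g').
Proof.
move=> wP bC /eqmod_sub0/(eqmod_divide wP bC)[g fE]; exists g => // g' gg'.
move=> S phi v Cv; rewrite -[f](subrK g1) evalvD (fE _ _ _ Cv) [RHS]evalvD addrC.
by rewrite !evalvM (gg' _ _ _ Cv).
Qed.

End Monomials.

(** * Monomial expansions adapted to the star configuration *)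

Section NormalForm.
Variables (K : fieldType) (d : nat) (I : finType) (F : I -> 'cV[K]_d).
Variables (Y : {set I}) (n : nat).
Implicit Types (f g : {mpoly K[d]}) (B C D J : {set I}) (c : {ffun I -> nat}).

Hypothesis dualF : forall B b, (#|B :\: Y| <= n.+1)%N -> b \in B ->
  exists w, dual_vector F B b w.
Hypothesis spanF : forall f, mspan F xpredT f.

Local Notation lin b := (linform (F b)).
Local Notation fmon c := (fmon F c).
Local Notation mspan := (mspan F).
Local Notation sumn J c := (\sum_(j in J) c j)%N.

(* The family of orders of vanishing has to be generalised to k - d(J), since
   dividing by a form lowers only the orders along its own subspaces.  Cutting
   with the hyperplane of least d makes the monomials found on the hyperplane
   vanish to the required order along the other subspaces too. *)
Lemma star_normal_form e B k (m : {ffun I -> nat}) f :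
  [disjoint B & Y] -> (#|B| + e <= n)%N ->
  (forall J, J \subset ~: (Y :|: B) -> #|J| = e ->
     ordge F (Y :|: B :|: J) (Y :|: B) (k - sumn J m) f) ->
  exists2 g, eqmod F (Y :|: B) f g &
    mspan (fun c => forall J, J \subset ~: (Y :|: B) -> #|J| = e ->
             (k <= sumn J m + sumn J c)%N) g.
Proof.
elim: e B k m f => [|e IHe] B k m f BY Be fJ.
  have [k0|k0] := posnP k.
    exists f => //; apply: mspanW (spanF f) => c _ J _ _.
    by rewrite k0.
  (* Only J = [set0] has size 0; f has positive order along the space Y :|: B = 0 itself, so it
     vanishes there. *)
  exists 0; last exact: mspan0.
  have := fJ set0 (sub0set _) (cards0 _).
  rewrite big_set0 subn0 setU0 -(prednK k0); exact: ordge_same.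
(* The inner induction is on the total distance of the shifts m from k; raising m b by one shortens
   it. *)
have [p] := ubnP (\sum_b (k - m b))%N; elim: p m f fJ => // p IHp m f fJ.
rewrite ltnS => mp.
have [/existsP[b0 /andP[b0B b0k]]|/existsPn full] :=
    boolP [exists b, (b \in ~: (Y :|: B)) && (m b < k)%N]; last first.
  (* All shifts have reached k, so any single index of J already gives the bound. *)
  exists f => //; apply: mspanW (spanF f) => c _ J JB Je.
  have /card_gt0P[j jJ] : (0 < #|J|)%N by rewrite Je.
  have := full j; rewrite (subsetP JB _ jJ) /= -leqNgt => mj.
  by rewrite (leq_trans mj) // (bigD1 j) //= -addnA leq_addr.
pose b := [arg min_(b < b0 in ~: (Y :|: B)) m b].
have [bB bmin] : b \in ~: (Y :|: B) /\
    forall j, j \in ~: (Y :|: B) -> (m b <= m j)%N.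
  by rewrite /b; case: arg_minnP.
have bk : (m b < k)%N by apply: leq_ltn_trans b0k; apply: bmin.
have bYB : b \notin Y :|: B by rewrite inE in bB.
have [bY bnB] : b \notin Y /\ b \notin B.
  by move: bYB; rewrite inE negb_or => /andP.
have cardY C : #|(Y :|: C) :\: Y| = #|C :\: Y|.
  by rewrite finset.setDUl finset.setDv finset.set0U.
have leY C : (#|(Y :|: C) :\: Y| <= #|C|)%N.
  by rewrite cardY subset_leq_card // finset.subsetDl.
have dualb C : (#|C| <= n)%N -> exists w, dual_vector F (b |: (Y :|: C)) b w.
  move=> Cn; apply: dualF; last exact: setU11.
  rewrite finset.setUCA; apply: leq_trans (leY _) _.
  by rewrite cardsU1; move: Cn; clear; lia.
have Bn : (#|B| <= n)%N by move: Be; clear; lia.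
have {}BY1 : [disjoint b |: B & Y].
  rewrite -setI_eq0 finset.setIUl (_ : B :&: Y = set0); last first.
    by apply/eqP; rewrite setI_eq0.
  by rewrite finset.setU0 setI_eq0 disjoints1.
(* On the hyperplane of b a set J of size e stands for b |: J, whose prescribed order contains the
   summand m b; this is subtracted from k. *)
have [|J JB Je|g1 fg1 g1P] := IHe (b |: B) (k - m b)%N m f BY1.
- by rewrite cardsU1 bnB; move: Be; clear; lia.
- have bJ : b \notin J.
    by apply/negP => /(subsetP JB); rewrite !inE eqxx !orbT.
  have := fJ (b |: J); rewrite big_setU1 //= cardsU1 bJ Je subnDA.
  have -> : Y :|: B :|: (b |: J) = Y :|: (b |: B) :|: J.
    by rewrite !finset.setUA (finset.setUAC Y B).
  move=> fbJ; apply: ordgeW (fbJ _ _) => //.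
    by rewrite finset.setUS // finset.subsetUr.
  rewrite finset.subUset finset.sub1set bB (fintype.subset_trans JB) //.
  by rewrite finset.setCS finset.setUS // finset.subsetUr.
(* Here minimality of m b is used: the index j removed from J satisfies m b <= m j, which
   compensates for the lowered k. *)
have lift1 J c : J \subset ~: (Y :|: B) -> #|J| = e.+1 ->
    (forall J', J' \subset ~: (Y :|: (b |: B)) -> #|J'| = e ->
      (k - m b <= sumn J' m + sumn J' c)%N) ->
    (k <= sumn J m + sumn J c)%N.
  move=> JB Je cP.
  have [j jJ] : exists2 j, j \in J & J :\ j \subset ~: (Y :|: (b |: B)).
    have [bJ|bJ] := boolP (b \in J).
      exists b => //; apply/subsetP => i; rewrite !inE => /andP[ib iJ].
      by have := subsetP JB _ iJ; rewrite !inE (negPf ib).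
    have /card_gt0P[j jJ] : (0 < #|J|)%N by rewrite Je.
    exists j => //; apply/subsetP => i; rewrite !inE => /andP[ij iJ].
    have ib : i != b by apply: contraNneq bJ => <-.
    by have := subsetP JB _ iJ; rewrite !inE (negPf ib).
  move=> /cP; have := cardsD1 j J; rewrite jJ Je add1n => -[<-] /(_ erefl) le1.
  rewrite !(big_setD1 j jJ) /=; move: (bmin j (subsetP JB _ jJ)) le1.
  by clear; lia.
have g1Q : mspan (fun c => forall J, J \subset ~: (Y :|: B) -> #|J| = e.+1 ->
             (k <= sumn J m + sumn J c)%N) g1.
  by apply: mspanW g1P => c cP J JB Je; apply: lift1.
have [w wP] := dualb B Bn.
have fg1' : eqmod F (b |: (Y :|: B)) f g1 by rewrite finset.setUCA.
have [g2 g2E g2P] := eqmod_lift wP bYB fg1'.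
have ord2 J : J \subset ~: (Y :|: B) -> #|J| = e.+1 ->
    ordge F (Y :|: B :|: J) (Y :|: B) (k - sumn J m) (lin b * g2).
  move=> JB Je; apply: ordge_eqmod g2E _; first exact: finset.subsetUl.
  apply: ordgeB; first exact: fJ.
  apply: ordge_mspan g1Q => c /(_ J JB Je) cJ.
  rewrite leq_subLR (leq_trans cJ) // leq_add2l.
  rewrite [leqRHS](big_setID J) /= (_ : _ :&: J = J) ?leq_addr //.
  by apply/finset.setIidPr/finset.subsetUr.
(* Division by the form of b costs one order along the J containing b and nothing along the others;
   [incr b m] records this. *)
have [||g3 g23 g3P] := IHp (incr b m) g2.
- move=> J JB Je; rewrite sum_incr; have := ord2 J JB Je.
  case: (boolP (b \in J)) => bJ.
    rewrite addn1 subnS; case: (k - sumn J m)%N => [|q] /=.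
      by move=> _; apply: ordge0.
    apply: ordge_colon_in wP => //; first exact: finset.subsetUl.
    by rewrite finset.in_setU bJ orbT.
  rewrite addn0; have [|w' w'P] := dualb (B :|: J).
    by rewrite (leq_trans (leq_card_setU _ _)) // Je.
  apply: (ordge_colon_out (w := w')); last by rewrite -finset.setUA.
  by rewrite finset.in_setU negb_or bYB bJ.
- apply: leq_trans mp; rewrite [ltnRHS](bigD1 b) //= (bigD1 b) //=.
  rewrite ffunE eqxx addn1 -addSn; apply: leq_add; first by move: bk; clear; lia.
  by apply: leq_sum => i /negPf ib; rewrite ffunE ib addn0.
exists (g1 + lin b * g3); first exact: g2P.
apply: mspanD => //; apply: mspan_lin g3P => c cP J JB Je.
by move: (cP J JB Je); rewrite !sum_incr; clear; lia.
Qed.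

(** The forms in Y are brought back one at a time. Each y belongs to every Y :|: J, so dividing by
    it lowers all orders equally, and k can be lowered without any shifts. *)
Lemma star_cone_normal_form e C k f :
  (e <= n)%N -> C \subset Y ->
  (forall J, J \subset ~: Y -> #|J| = e -> ordge F (Y :|: J) C k f) ->
  exists2 g, eqmod F C f g &
    mspan (fun c => forall J, J \subset ~: Y -> #|J| = e ->
             (k <= sumn (Y :|: J) c)%N) g.
Proof.
move=> en; have [p] := ubnP #|Y :\: C|; elim: p C k f => // p IHp C k f.
rewrite ltnS => Cp CY.
have [/existsP[y /andP[yY yC]] fJ|/existsPn full fJ] :=
    boolP [exists y, (y \in Y) && (y \notin C)]; last first.
  have CE : C = Y.
    apply/eqP; rewrite eqEsubset CY; apply/subsetP => y yY.
    by have := full y; rewrite yY /= negbK.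
  have := @star_normal_form e set0 k [ffun=> 0%N] f.
  rewrite finset.setU0 cards0 -setI_eq0 finset.set0I.
  case=> // [J JY Je|g fg gP].
    by rewrite -{2}CE; apply: ordge_le (fJ J JY Je); apply: leq_subr.
  exists g; rewrite ?CE //; apply: mspanW gP => c cP J JY Je.
  have := cP J JY Je.
  rewrite big1 => [|i _]; last by rewrite ffunE.
  move=> /leq_trans; apply.
  rewrite add0n [leqRHS](big_setID J) /= (_ : _ :&: J = J) ?leq_addr //.
  by apply/finset.setIidPr/finset.subsetUr.
have yCY : y |: C \subset Y by rewrite finset.subUset finset.sub1set yY.
have [w wP] : exists w, dual_vector F (y |: C) y w.
  apply: dualF (setU11 _ _); rewrite (_ : _ :\: _ = set0) ?cards0 //.
  by apply/eqP; rewrite finset.setD_eq0.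
elim: k f fJ => [|k IHk] f fJ.
  by exists f => //; apply: mspanW (spanF f).
have [||J JY Je|g1 fg1 g1P] := IHp (y |: C) k.+1 f => //.
- apply: leq_trans Cp; apply: proper_card; apply/properP; split.
    by rewrite finset.setDS // finset.subsetUr.
  by exists y; rewrite !inE ?yC ?eqxx.
- by apply: ordgeW (fJ J JY Je); apply: finset.subsetUr.
have [g2 g2E g2P] := eqmod_lift wP yC fg1.
have [J JY Je|g3 g23 g3P] := IHk g2.
  have yJ : y \in Y :|: J by rewrite finset.in_setU yY.
  have CJ : C \subset Y :|: J.
    by rewrite (fintype.subset_trans CY) // finset.subsetUl.
  apply: (ordge_colon_in CJ yJ yC wP); apply: ordge_eqmod g2E _ => //.
  apply: ordgeB; first exact: fJ.
  by apply: ordge_mspan g1P => c; apply.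
exists (g1 + lin y * g3); first exact: g2P.
apply: mspanD => //; apply: mspan_lin g3P => c cP J JY Je.
by rewrite sum_incr finset.in_setU yY addn1 ltnS; apply: cP.
Qed.

Lemma union_normal_form e k f :
  (e <= n)%N ->
  (forall J, J \subset ~: Y -> #|J| = e -> ordge F (Y :|: J) set0 k f) ->
  mspan (fun c => forall J, J \subset ~: Y -> #|J| = e ->
             (k <= sumn (Y :|: J) c)%N) f.
Proof.
move=> en fJ; have [g fg gP] := star_cone_normal_form en (sub0set _) fJ.
by rewrite (eqmod_set0 fg).
Qed.

End NormalForm.

(** * Generated ideals and their powers *)

Section Ideals.
Variable A : comNzRingType.
Implicit Types (I : A -> Prop) (f g : A).

Lemma ideal_genMl (S : A -> Prop) f g : ideal_gen S g -> ideal_gen S (f * g).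
Proof.
move=> [k [a [s [sS ->]]]]; exists k, (fun i => f * a i), s; split=> //.
by rewrite mulr_sumr; apply: eq_bigr => i _; rewrite mulrA.
Qed.

Lemma ideal_genD (S : A -> Prop) f g :
  ideal_gen S f -> ideal_gen S g -> ideal_gen S (f + g).
Proof.
move=> [k [a [s [sS ->]]]] [l [b [t [tS ->]]]].
exists (k + l)%N, (fun i => match split i with inl x => a x | inr y => b y end),
  (fun i => match split i with inl x => s x | inr y => t y end).
split=> [i|]; first by case: (split i).
rewrite big_split_ord /=; congr (_ + _); apply: eq_bigr => i _.
  by rewrite -[lshift _ _]/(unsplit (inl i)) unsplitK.
by rewrite -[rshift _ _]/(unsplit (inr i)) unsplitK.
Qed.

Lemma ideal_gen0 (S : A -> Prop) : ideal_gen S 0.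
Proof.
exists 0%N, (fun _ => 0), (fun _ => 0); split; first by case.
by rewrite big_ord0.
Qed.

Lemma ideal_gen_in (S : A -> Prop) f : S f -> ideal_gen S f.
Proof.
move=> Sf; exists 1%N, (fun _ => 1), (fun _ => f); split=> //.
by rewrite big_ord1 mul1r.
Qed.

Lemma ideal_gen_ind (S P : A -> Prop) :
  P 0 -> (forall f g, P f -> P g -> P (f + g)) ->
  (forall a s, S s -> P (a * s)) -> forall f, ideal_gen S f -> P f.
Proof.
move=> P0 PD PM _ [k [a [s [sS ->]]]].
by elim/big_rec: _ => // i x _; apply/PD/PM.
Qed.

Lemma ideal_pow0 I f : ideal_pow I 0 f.
Proof.
rewrite -[f]mulr1; apply/ideal_genMl/ideal_gen_in.
by exists (fun _ => 0); split; [case | rewrite big_ord0].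
Qed.

Lemma ideal_pow_ind I r (P : A -> Prop) :
  P 0 -> (forall f g, P f -> P g -> P (f + g)) ->
  (forall a (h : 'I_r -> A), (forall i, I (h i)) -> P (a * \prod_i h i)) ->
  forall f, ideal_pow I r f -> P f.
Proof.
by move=> P0 PD PM; apply: ideal_gen_ind => // a _ [g [gI ->]]; apply: PM.
Qed.

Lemma ideal_powS I r f g : I f -> ideal_pow I r g -> ideal_pow I r.+1 (f * g).
Proof.
move=> If; move: g; apply: ideal_pow_ind => [|g1 g2 I1 I2|a h hI].
- by rewrite mulr0; apply: ideal_gen0.
- by rewrite mulrDr; apply: ideal_genD.
rewrite mulrCA; apply/ideal_genMl/ideal_gen_in.
exists (fun i => if unlift ord0 i is Some j then h j else f); split=> [i|].
  by case: (unlift ord0 i).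
rewrite big_ord_recl /= unlift_none; congr (_ * _).
by apply: eq_bigr => i _; rewrite liftK.
Qed.

Lemma ideal_pow_le I q r f : (q <= r)%N -> ideal_pow I r f -> ideal_pow I q f.
Proof.
move=> /subnKC<-; elim: (r - q)%N => [|k IH]; first by rewrite addn0.
rewrite addnS => fI; apply: IH; move: f fI; apply: ideal_pow_ind.
- exact: ideal_gen0.
- by move=> *; apply: ideal_genD.
move=> a g gI; rewrite big_ord_recl mulrA; apply/ideal_genMl/ideal_gen_in.
by eexists; split; last reflexivity.
Qed.

Lemma ideal_pow1 I f : I f -> ideal_pow I 1 f.
Proof. by move=> If; rewrite -[f]mulr1; apply/ideal_powS/ideal_pow0. Qed.

Lemma ideal_pow_Xn I r (S : nzRingType) (h : {rmorphism A -> {poly S}}) f :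
  (forall g, I g -> exists p, h g = 'X * p) ->
  ideal_pow I r f -> exists p, h f = 'X^r * p.
Proof.
move=> hI; move: f; apply: ideal_pow_ind.
- by exists 0; rewrite rmorph0 mulr0.
- move=> f1 f2 [p1 e1] [p2 e2]; exists (p1 + p2).
  by rewrite rmorphD e1 e2 mulrDr.
move=> a g /(_ _)/hI gI; rewrite rmorphM rmorph_prod.
suff [p ->] : exists p, \prod_(i < r) h (g i) = 'X^r * p.
  by exists (h a * p); rewrite mulrA commr_polyXn mulrA.
elim: r g gI => [|k IH] g gI; first by exists 1; rewrite big_ord0 mulr1.
rewrite big_ord_recl; have [p ->] := gI ord0.
have [q ->] := IH _ (fun i => gI (lift ord0 i)).
by exists (p * q); rewrite exprS -!mulrA (mulrA p) commr_polyXn !mulrA.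
Qed.

End Ideals.

(** * From ideals of linear varieties to orders of vanishing *)

Section LinearIdeals.
Variables (K : fieldType) (d : nat).
Implicit Types (V : {vspace 'rV[K]_d}) (f g : {mpoly K[d]}).

Lemma vanishes_evalv V p (M : 'M[K]_(p, d)) (L : fieldType)
    (phi : {rmorphism K -> L}) (a : 'rV[L]_p) f :
  (forall i, row i M \in V) -> vanishes_on V f ->
  a *m map_mx phi M != 0 -> evalv phi (a *m map_mx phi M) f = 0.
Proof.
move=> MV fV aM; apply: (fV L phi _ aM).
have mapV w : w \in V -> map_mx phi w \in <<[seq map_mx phi w | w <- vbasis V]>>%VS.
  move=> /coord_vbasis->; rewrite raddf_sum; apply: rpred_sum => i _ /=.
  rewrite map_mxZ; apply: rpredZ; apply: memv_span.
  by apply: map_f; apply: mem_nth; rewrite size_tuple.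
rewrite mulmx_sum_row; apply: rpred_sum => i _; apply: rpredZ.
by rewrite -map_row; apply: mapV.
Qed.

(** [vanishes_on] concerns nonzero points over fields. For a possibly zero point over a domain, a
    nonzero vector of V is added with a new parameter as coefficient; the fraction field applies,
    and the parameter is then set to 0. *)
Lemma linear_ideal_evalv V p (M : 'M[K]_(p, d)) (S : idomainType)
    (phi : {rmorphism K -> S}) (a : 'rV[S]_p) f :
  (forall i, row i M \in V) -> V != 0%VS -> linear_ideal V f ->
  evalv phi (a *m map_mx phi M) f = 0.
Proof.
move=> MV V0; move: f; apply: ideal_gen_ind => [|f1 f2 e1 e2|b s [_ sV]].
- exact: evalv0.
- by rewrite evalvD e1 e2 addr0.
rewrite evalvM [X in _ * X](_ : _ = 0) ?mulr0 //.
pose w := vpick V; have wV : w \in V by apply: memv_pick.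
have w0 : w != 0 by rewrite vpick0.
pose phi' : {rmorphism K -> {poly S}} := polyC \o phi.
pose psi : {rmorphism K -> {fraction {poly S}}} := @tofrac {poly S} \o phi'.
pose M' := col_mx M w.
pose a' : 'rV[{poly S}]_(p + 1) := row_mx (map_mx polyC a) ('X)%:M.
have v'E : a' *m map_mx phi' M' =
    map_mx polyC (a *m map_mx phi M) + 'X *: map_mx phi' w.
  rewrite map_col_mx mul_row_col mul_scalar_mx; congr (_ + _).
  by rewrite map_mxM -map_mx_comp.
have M'V i : row i M' \in V.
  rewrite -[i]splitK; case: (split i) => j /=.
    by rewrite rowKu.
  rewrite rowKd (_ : row j w = w) //.
  by apply/rowP => k; rewrite !mxE ord1.
have v'0 : a' *m map_mx phi' M' != 0.
  have [i wi] : exists i, w 0 i != 0.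
    apply/existsP; apply: contraNT w0; rewrite negb_exists => /forallP w00.
    apply/eqP/rowP => i; rewrite mxE; apply/eqP; have := w00 i.
    by rewrite negbK.
  apply: contraNneq wi => /rowP/(_ i)/(congr1 (fun q : {poly S} => q`_1)).
  rewrite v'E !mxE coefD coefC add0r coefXM /= coefC /= coef0 => /eqP.
  by rewrite fmorph_eq0.
have : evalv phi' (a' *m map_mx phi' M') s = 0.
  apply/eqP; rewrite -tofrac_eq0 evalv_rmorph map_mxM -map_mx_comp.
  apply/eqP; apply: (@vanishes_evalv V _ M' _ psi) => //.
  rewrite (map_mx_comp phi' (@tofrac {poly S})) -map_mxM.
  apply/negP => /eqP/matrixP v0; case/eqP: v'0.
  apply/matrixP => i j; have /eqP := v0 i j.
  by rewrite [X in X == _]mxE [X in _ == X]mxE [RHS]mxE tofrac_eq0 => /eqP.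
move=> /(congr1 (horner_eval 0)); rewrite evalv_rmorph v'E -row_deform.
rewrite [X in _ = X -> _]/horner_eval horner0 => <-; apply: eq_evalv => c /=.
by rewrite /horner_eval hornerC.
Qed.

Lemma ideal_pow_evalv V p (M : 'M[K]_(p, d)) (S : idomainType)
    (phi : {rmorphism K -> S}) (a : 'rV[S]_p) (x : 'rV[S]_d) r f :
  (forall i, row i M \in V) -> V != 0%VS -> ideal_pow (linear_ideal V) r f ->
  exists g : {poly S},
    evalv (polyC \o phi)
      (map_mx polyC (a *m map_mx phi M) + 'X *: map_mx polyC x) f = 'X^r * g.
Proof.
move=> MV V0; set v := map_mx _ _ + _.
apply: (ideal_pow_Xn (h := mmap (polyC \o phi) (fun i => v 0 i))) => g gV.
have /factor_theorem[q qE] : root (evalv (polyC \o phi) v g) 0.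
  rewrite rootE -[_.[0]]/(horner_eval 0 _) evalv_rmorph -row_deform.
  rewrite -[X in _ == X](linear_ideal_evalv phi a MV V0 gV); apply/eqP.
  by apply: eq_evalv => c /=; rewrite /horner_eval hornerC.
by exists q; rewrite -[LHS]/(evalv (polyC \o phi) v g) qE subr0 mulrC.
Qed.

Lemma linform_homog (a : 'cV[K]_d) : linform a \is 1.-homog.
Proof.
by apply: rpred_sum => i _; apply: rpredZ; rewrite dhomogX /= mdeg1.
Qed.

Lemma linform_in_ideal V (a : 'cV[K]_d) :
  (forall w, w \in V -> w *m a = 0) -> linear_ideal V (linform a).
Proof.
move=> aV; apply: ideal_gen_in; split; first by exists 1%N; apply: linform_homog.
move=> L phi v _ vV; rewrite -[LHS]/(evalv phi v _) evalv_linform.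
suff -> : v *m map_mx phi a = 0 by rewrite mxE.
rewrite (coord_span vV) mulmx_suml big1 // => i _.
rewrite -scalemxAl (nth_map 0) ?size_tuple // -map_mxM aV ?map_mx0 ?scaler0 //.
by apply: vbasis_mem; apply: mem_nth; rewrite size_tuple.
Qed.

Lemma linform_sum (T : finType) (k : T -> K) (a : T -> 'cV[K]_d) (B : {set T}) :
  linform (\sum_(b in B) k b *: a b) = \sum_(b in B) k b *: linform (a b).
Proof.
rewrite /linform; under [RHS]eq_bigr do rewrite scaler_sumr.
rewrite exchange_big /=; apply: eq_bigr => i _.
rewrite summxE scaler_suml; apply: eq_bigr => b _.
by rewrite mxE scalerA.
Qed.

End LinearIdeals.

(** * Linear algebra of the forms, and subsets of given size *)

(** M is the projection 1 - E E' onto the common zeros, with E E' E = E. Being defined over K, it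
    parametrises the zeros over every K-algebra, in the shape that [ideal_pow_evalv] expects. *)
Lemma zeros_param (K : fieldType) (d : nat) (I : finType) (F : I -> 'cV[K]_d)
    (B : {set I}) :
  exists2 M : 'M[K]_d, (forall i b, b \in B -> row i M *m F b = 0) &
    forall (S : comNzRingType) (phi : {rmorphism K -> S}) v,
      zeros F phi B v -> v = v *m map_mx phi M.
Proof.
pose E : 'M[K]_(d, #|I|) :=
  \matrix_(i, k) if enum_val k \in B then F (enum_val k) i 0 else 0.
pose M := 1%:M - E *m pinvmx E.
have ME : M *m E = 0 by rewrite mulmxBl mul1mx mulmxKpV ?subrr.
exists M => [i b bB|S phi v vB].
  have -> : F b = col (enum_rank b) E.
    by apply/colP => k; rewrite !mxE enum_rankK bB.
  by rewrite -row_mul colE mulmxA ME mul0mx row0.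
suff vE : v *m map_mx phi E = 0.
  by rewrite map_mxB map_mx1 map_mxM mulmxBr mulmx1 mulmxA vE mul0mx subr0.
apply/rowP => k; rewrite mxE [RHS]mxE.
have [kB|kB] := boolP (enum_val k \in B); last first.
  by rewrite big1 // => i _; rewrite !mxE (negPf kB) rmorph0 mulr0.
have := vB _ kB; rewrite evalv_linform mxE => vk; rewrite -[RHS]vk.
by apply: eq_bigr => i _; rewrite !mxE kB.
Qed.

(** The dual vectors form a left inverse of the square matrix of the forms, which is also a right
    inverse. *)
Lemma dual_expand (K : fieldType) (d : nat) (I : finType) (F : I -> 'cV[K]_d)
    (B : {set I}) :
  #|B| = d -> (forall b, b \in B -> exists w, dual_vector F B b w) ->
  forall a : 'cV[K]_d, exists k : I -> K, a = \sum_(b in B) k b *: F b.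
Proof.
move=> Bd dB a.
have [w wP] : exists w : 'I_#|B| -> 'rV[K]_d,
    forall i, dual_vector F B (enum_val i) (w i).
  apply: (@fin_all_exists _ _ (fun i w => dual_vector F B (enum_val i) w)) => i.
  exact/dB/enum_valP.
subst d.
pose E : 'M[K]_#|B| := \matrix_(i, k) F (enum_val k) i 0.
pose D : 'M[K]_#|B| := \matrix_(i, k) w i 0 k.
have DE : D *m E = 1%:M.
  apply/matrixP => i k; rewrite [RHS]mxE.
  have -> : (D *m E) i k = (w i *m F (enum_val k)) 0 0.
    by rewrite !mxE; apply: eq_bigr => j _; rewrite !mxE.
  have [w1 w0] := wP i; have [<-|ik] := eqVneq i k; first by rewrite w1 mxE.
  rewrite w0 ?mxE ?enum_valP //.
  by apply: contraNneq ik => /enum_val_inj->.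
have EDa : E *m (D *m a) = a by rewrite mulmxA (mulmx1C DE) mul1mx.
pose c := D *m a.
exists (fun b => \sum_(i | enum_val i == b) c i 0).
have kE k : \sum_(i | enum_val i == enum_val k) c i 0 = c k 0.
  rewrite (big_pred1 k) // => j /=; apply/eqP/eqP => [|->//].
  exact: enum_val_inj.
rewrite big_enum_val /= -[LHS]EDa; apply/colP => i; rewrite [LHS]mxE summxE.
apply: eq_bigr => k _; rewrite kE [RHS]mxE mulrC; congr (_ * _).
by rewrite mxE.
Qed.

Lemma subset_of_card (T : finType) (A : {set T}) k :
  (k <= #|A|)%N -> exists2 B : {set T}, B \subset A & #|B| = k.
Proof.
move=> kA; exists [set x in take k (enum A)].
  by apply/subsetP => x; rewrite inE => /mem_take; rewrite mem_enum.
rewrite cardsE; have /card_uniqP-> : uniq (take k (enum A)).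
  exact/take_uniq/enum_uniq.
by rewrite size_takel // -cardE.
Qed.

(** * Vanishing at a point, imposed on an expansion *)

Section PointFilter.
Variables (K : fieldType) (d : nat) (I : finType) (F : I -> 'cV[K]_d).
Implicit Types (f g : {mpoly K[d]}) (B J : {set I}) (c : {ffun I -> nat}).

Local Notation lin b := (linform (F b)).
Local Notation mon := (fmon F).
Local Notation mspan := (mspan F).

(* Scaling by 'X all the forms but the form y multiplies a monomial c
   by 'X^(deg c - c y). *)
Lemma mspan_point_filter (y : I) (p : 'rV[K]_d) m P f :
  dual_vector F [set: I] y p -> mspan P f ->
  (forall x : 'rV[{mpoly K[d]}]_d, exists g : {poly {mpoly K[d]}},
     evalv (polyC \o @mpolyC d K)
       (map_mx polyC ((lin y)%:M *m map_mx (@mpolyC d K) p)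
        + 'X *: map_mx polyC x) f = 'X^m * g) ->
  mspan (fun c => P c /\ (m + c y <= \sum_b c b)%N) f.
Proof.
move=> [py p0] [r rP fE] fm.
(* v is the component of the generic point along p and x the rest; thus y is constant on v + t x,
   and every other form is multiplied by t. *)
pose v : 'rV_d := (lin y)%:M *m map_mx (@mpolyC d K) p.
pose x := generic_point K d - v.
pose h := evalv (polyC \o @mpolyC d K) (map_mx polyC v + 'X *: map_mx polyC x).
have hy b : evalv (@mpolyC d K) v (lin b) = if b == y then lin y else 0.
  rewrite evalv_linform /v mul_scalar_mx -scalemxAl -map_mxM mxE.
  case: eqP => [->|/eqP b_y]; first by rewrite py map_mx1 mxE mulr1.
  by rewrite p0 ?inE // map_mx0 mxE mulr0.
have hx b : evalv (@mpolyC d K) x (lin b) = if b == y then 0 else lin b.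
  rewrite /x -scaleN1r evalv_linD evalv_generic hy mulN1r.
  by case: eqP => [->|_]; rewrite ?subrr ?subr0.
have hlin b : h (lin b) = if b == y then (lin b)%:P else 'X * (lin b)%:P.
  rewrite /h evalv_linD -!evalv_rmorph hy hx.
  by case: eqP => [->|_]; rewrite ?polyC0 ?mulr0 ?addr0 ?add0r.
have hfmon c : h (mon c) = 'X^(\sum_b c b - c y) * (mon c)%:P.
  rewrite {1}/fmon /h /evalv rmorph_prod /fmon rmorph_prod /=.
  rewrite (bigD1 y) //= [in RHS](bigD1 y) //= (bigD1 y (P := predT)) //= addKn.
  rewrite !rmorphXn mulrCA; congr (_ * _).
    by congr (_ ^+ _); have := hlin y; rewrite eqxx.
  rewrite -prodrXr -big_split /=; apply: eq_bigr => b /negPf b_y.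
  rewrite !rmorphXn -exprMn; congr (_ ^+ _).
  by have := hlin b; rewrite b_y.
(* [low] is zero on h f and keeps exactly the terms violating the bound. These terms add up to zero,
   so they may be deleted even if the monomials are dependent. *)
pose low (q : {poly {mpoly K[d]}}) := \sum_(j < m) q`_j.
have lowD q q' : low (q + q') = low q + low q'.
  by rewrite -big_split; apply: eq_bigr => j _; rewrite coefD.
have lowZ a q : low (a%:P * q) = a * low q.
  by rewrite mulr_sumr; apply: eq_bigr => j _; rewrite coefCM.
have lowX k q : low ('X^k * q%:P) = if (k < m)%N then q else 0.
  rewrite /low; under eq_bigr do rewrite coefXnM coefC subn_eq0.
  case: ltnP => km.
    rewrite (bigD1 (Ordinal km)) //= ltnn leqnn big1 ?addr0 // => j jk.
    case: ltnP => // kj; rewrite leqNgt ltn_neqAle kj andbT.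
    by rewrite eq_sym -[k]/(val (Ordinal km)) (inj_eq val_inj) jk.
  by rewrite big1 // => j _; rewrite (leq_trans (ltn_ord j) km).
have lowh a c : low (h (a *: mon c)) =
    if (m + c y <= \sum_b c b)%N then 0 else a *: mon c.
  rewrite /h /evalv mmapZ /= lowZ mul_mpolyC -/(evalv _ _ _) -/h hfmon lowX.
  have cy : (c y <= \sum_b c b)%N by rewrite (bigD1 y) //= leq_addr.
  by rewrite ltnNge (leq_subRL _ cy) addnC; case: leqP; rewrite ?scaler0.
have lowf : low (h f) = 0.
  have [g ->] : exists g : {poly {mpoly K[d]}}, h f = 'X^m * g := fm x.
  rewrite /low big1 // => j _.
  by rewrite coefXnM ltn_ord.
pose good (z : K * {ffun I -> nat}) := (m + z.2 y <= \sum_b z.2 b)%N.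
exists [seq z <- r | good z].
  by move=> z; rewrite mem_filter => /andP[? /rP].
rewrite big_filter fE (bigID good) /=.
suff e : \sum_(z <- r | ~~ good z) z.1 *: mon z.2 = low (h f).
  by rewrite e lowf addr0.
rewrite fE big_mkcond /=.
have -> : low (h (\sum_(z <- r) z.1 *: mon z.2)) =
    \sum_(z <- r) low (h (z.1 *: mon z.2)).
  apply: (big_morph (fun g => low (h g))) => [g1 g2|].
    by rewrite /h evalvD lowD.
  by rewrite /h evalv0 /low big1 // => j _; rewrite coef0.
by apply: eq_bigr => z _; rewrite lowh /good; case: leqP.
Qed.

End PointFilter.

(** * Symbolic powers of the union as spans of monomials *)

Section Configuration.
Variables (K : fieldType) (d : nat) (I : finType) (F : I -> 'cV[K]_d).
Variables (Y : {set I}) (n e : nat) (pt : I -> 'rV[K]_d).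
Variables (Vs : {set I} -> {vspace 'rV[K]_d}) (G : {vspace 'rV[K]_d} -> Prop).
Implicit Types (f : {mpoly K[d]}) (B J : {set I}) (c : {ffun I -> nat}).

Hypothesis dualF : forall B b, (#|B :\: Y| <= n.+1)%N -> b \in B ->
  exists w, dual_vector F B b w.
Hypothesis cardY : (#|Y| + n.+1 = d)%N.
Hypothesis cardL : (n < #|~: Y|)%N.
Hypothesis en : (e <= n)%N.
Hypothesis ptP : forall y, y \in Y -> dual_vector F [set: I] y (pt y).
Hypothesis VsP : forall J v, J \subset ~: Y -> #|J| = e ->
  (v \in Vs J <-> forall b, b \in Y :|: J -> v *m F b = 0).
Hypothesis GE : forall V, G V <->
  (exists2 y, y \in Y & V = <[pt y]>%VS) \/
  (exists J, [/\ J \subset ~: Y, #|J| = e & V = Vs J]).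

Local Notation lin b := (linform (F b)).
Local Notation mon := (fmon F).

Definition union_monomial m c : Prop :=
  (forall J, J \subset ~: Y -> #|J| = e -> (m <= \sum_(b in Y :|: J) c b)%N) /\
  (forall y, y \in Y -> (m + c y <= \sum_b c b)%N).

Lemma columns_span (T : {set I}) (a : 'cV[K]_d) :
  T \subset ~: Y -> #|T| = n.+1 ->
  exists k : I -> K, a = \sum_(b in Y :|: T) k b *: F b.
Proof.
move=> TY Tn; have YT : [disjoint Y & T].
  by rewrite disjoint_sym disjoints_subset.
apply: dual_expand.
  rewrite finset.cardsU (_ : Y :&: T = set0) ?cards0 ?subn0 ?Tn //.
  by apply/eqP; rewrite setI_eq0.
move=> b; apply: dualF; rewrite finset.setDUl finset.setDv finset.set0U -Tn.
by rewrite subset_leq_card // finset.subsetDl.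
Qed.

Lemma mspan_all f : mspan F xpredT f.
Proof.
have [T TY Tn] := subset_of_card cardL.
apply: mspan_total => i.
have [k kE] := columns_span (delta_mx i 0) TY Tn.
exists (fun b => if b \in Y :|: T then k b else 0).
have -> : 'X_i = linform (delta_mx i 0 : 'cV[K]_d).
  rewrite /linform (bigD1 i) //= mxE !eqxx scale1r big1 ?addr0 // => j /negPf ji.
  by rewrite mxE ji scale0r.
rewrite kE linform_sum big_mkcond; apply: eq_bigr => b _ /=.
by case: ifP; rewrite ?scale0r.
Qed.

(** The star forms vanish at [pt y], so evaluation there isolates the coefficient of y in the
    expansion and shows that it is zero. *)
Lemma lin_relation (T : {set I}) b :
  T \subset ~: Y -> #|T| = n.+1 -> b \notin Y ->
  exists k : I -> K, lin b = \sum_(j in T) k j *: lin j.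
Proof.
move=> TY Tn bY; have [k kE] := columns_span (F b) TY Tn.
exists k; rewrite {1}kE linform_sum (big_setID Y) /=.
rewrite (_ : (Y :|: T) :\: Y = T); last first.
  rewrite finset.setDUl finset.setDv finset.set0U; apply/setDidPl.
  by rewrite disjoints_subset.
rewrite big1 ?add0r // => y; rewrite inE => /andP[yYT yY].
have [py p0] := ptP yY.
have : pt y *m F b = 0 by apply: p0; rewrite ?inE //; apply: contraNneq bY => ->.
rewrite kE mulmx_sumr (bigD1 y) //= -scalemxAr py big1 => [|i /andP[_ iy]].
  by rewrite addr0 => /matrixP/(_ 0 0); rewrite !mxE mulr1 => ->; rewrite scale0r.
by rewrite -scalemxAr p0 ?inE // scaler0.
Qed.

(** As e <= n, some star index b lies outside J, and a vector dual to b relative to b |: (Y :|: J)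
    is nonzero in this space. *)
Lemma Vs_neq0 J : J \subset ~: Y -> #|J| = e -> Vs J != 0%VS.
Proof.
move=> JY Je; have /subset_of_card[T TY Tn] := cardL.
have [b bT bJ] : exists2 b, b \in ~: Y & b \notin J.
  have : ~~ (~: Y \subset J).
    apply/negP => /subset_leq_card; rewrite Je leqNgt.
    by rewrite (leq_ltn_trans en cardL).
  by move=> /subsetPn.
have bY : b \notin Y by rewrite inE in bT.
have [||w [w1 w0]] := @dualF (b |: (Y :|: J)) b; last 2 first.
- exact: setU11.
- apply/negP => /eqP V0; have : w \in Vs J.
    apply/(VsP _ JY Je) => i iYJ; apply: w0; first by rewrite inE iYJ orbT.
    by apply: contraTneq iYJ => ->; rewrite inE negb_or bY.
  rewrite V0 memv0 => /eqP w00; move: w1; rewrite w00 mul0mx.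
  by move/matrixP/(_ 0 0); rewrite !mxE => /eqP; rewrite eq_sym oner_eq0.
rewrite finset.setUCA finset.setDUl finset.setDv finset.set0U.
apply: leq_trans (subset_leq_card (finset.subsetDl _ _)) _.
by rewrite cardsU1 bJ Je.
Qed.

Lemma symbolic_power_mspan m f :
  symbolic_power G m f -> mspan F (union_monomial m) f.
Proof.
move=> fm.
have star : mspan F (fun c => forall J, J \subset ~: Y -> #|J| = e ->
    (m <= \sum_(b in Y :|: J) c b)%N) f.
  apply: (union_normal_form dualF mspan_all en) => J JY Je S phi v x vJ _.
  have [M MJ vM] := zeros_param F (Y :|: J).
  rewrite (vM _ _ _ vJ); apply: (@ideal_pow_evalv _ _ (Vs J)).
  - by move=> i; apply/(VsP _ JY Je) => b bJ; apply: MJ.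
  - exact: Vs_neq0.
  - by apply/fm/GE; right; exists J.
(* The points are imposed one by one; the conditions already reached persist because terms are only
   deleted. *)
suff H (s : seq I) : {subset s <= Y} ->
    mspan F (fun c => (forall J, J \subset ~: Y -> #|J| = e ->
      (m <= \sum_(b in Y :|: J) c b)%N) /\
      (forall y, y \in s -> (m + c y <= \sum_b c b)%N)) f.
  apply: mspanW (H (enum Y) _) => [c [cJ cY]|y]; last by rewrite mem_enum.
  by split=> // y yY; apply: cY; rewrite mem_enum.
elim: s => [|y s IH] sY; first by apply: mspanW star.
have yY : y \in Y by apply: sY; rewrite mem_head.
have {}IH := IH (fun z zs => sY z (mem_behead (s := y :: s) zs)).
have := mspan_point_filter (m := m) (ptP yY) IH.
have h (x : 'rV[{mpoly K[d]}]_d) : exists g : {poly {mpoly K[d]}},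
    evalv (polyC \o @mpolyC d K)
      (map_mx polyC ((lin y)%:M *m map_mx (@mpolyC d K) (pt y))
       + 'X *: map_mx polyC x) f = 'X^m * g.
  apply: (@ideal_pow_evalv _ _ <[pt y]>%VS).
  - move=> i; rewrite (_ : row i (pt y) = pt y) ?memv_line //.
    by apply/rowP => j; rewrite mxE ord1.
  - rewrite -subv0 -memvE memv0; apply/negP => /eqP p0.
    have [] := ptP yY; rewrite p0 mul0mx => /matrixP/(_ 0 0).
    by rewrite !mxE => /eqP; rewrite eq_sym oner_eq0.
  - by apply/fm/GE; left; exists y.
move=> /(_ h); apply: mspanW => c [[cJ cs] cy]; split=> // z.
by rewrite in_cons => /orP[/eqP->//|]; apply: cs.
Qed.

Lemma ideal_pow_mon (A : {mpoly K[d]} -> Prop) B c m :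
  (forall b, b \in B -> A (lin b)) -> (m <= \sum_(b in B) c b)%N ->
  ideal_pow A m (mon c).
Proof.
move=> AB mc; apply: (ideal_pow_le mc); rewrite big_mkcond /= /fmon.
elim/big_rec2: _ => [|b k p _ pk]; first exact: ideal_pow0.
have [bB|bB] := boolP (b \in B); last exact: ideal_genMl.
elim: (c b) => [|t IH]; first by rewrite expr0 mul1r.
by rewrite exprS -mulrA; apply: ideal_powS => //; apply: AB.
Qed.

Lemma symbolic_power_mon m c :
  union_monomial m c -> symbolic_power G m (mon c).
Proof.
move=> [cJ cY] V /GE[[y yY ->]|[J [JY Je ->]]].
  apply: (@ideal_pow_mon _ [set~ y]).
    move=> b; rewrite !inE => b_y; apply: linform_in_ideal => w /vlineP[k ->].
    by rewrite -scalemxAl; have [_ ->] := ptP yY; rewrite ?scaler0 ?inE.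
  have := cY y yY; rewrite (bigD1 y) //= addnC leq_add2l => /leq_trans; apply.
  by rewrite leq_eqVlt; apply/orP; left; apply/eqP/eq_bigl => b; rewrite !inE.
apply: (@ideal_pow_mon _ (Y :|: J)); last exact: cJ.
by move=> b bJ; apply: linform_in_ideal => w /(VsP _ JY Je); apply.
Qed.

Lemma union_ideal_mon c : union_monomial 1 c -> union_ideal G (mon c).
Proof.
move=> /symbolic_power_mon c1 V /c1.
apply: ideal_pow_ind => [|f g fV gV|a g gV]; first exact: ideal_gen0.
- exact: ideal_genD.
- by rewrite big_ord1; apply/ideal_genMl/gV.
Qed.

Lemma union_ideal_symbolic f : union_ideal G f -> symbolic_power G 1 f.
Proof. by move=> fG V /fG; apply: ideal_pow1. Qed.

End Configuration.

(** * Drawing sets of distinct colours from a multiset *)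

Section Colours.
Local Open Scope nat_scope.
Variable T : finType.
Implicit Types (b c : T -> nat) (S A J : {set T}).

Lemma leq_min_sum (P : pred T) b r :
  minn (\sum_(i | P i) b i) r <= \sum_(i | P i) minn (b i) r.
Proof.
elim/big_rec2: _ => [|i x y _ xy]; first by rewrite min0n.
by move: xy; clear; lia.
Qed.

(** With b i copies of colour i, the truncated sum is the criterion for drawing k + 1 disjoint sets
    of w distinct colours. Skipping a colour with more than k copies wastes one copy, so these
    colours are drawn first. *)
Lemma colour_step b w k :
  k.+1 * w <= \sum_i minn (b i) k.+1 ->
  exists S, [/\ #|S| = w, forall i, i \in S -> 0 < b i
    & k * w <= \sum_i minn (b i - (i \in S)) k].
Proof.
move=> kw; pose B := [set i | k < b i].
have [wB|Bw] := leqP w #|B|.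
  have [S SB Sw] := subset_of_card wB; exists S; split=> // [i /(subsetP SB)|].
    by rewrite inE; apply: leq_ltn_trans.
  rewrite -Sw mulnC -sum_nat_const big_mkcond; apply: leq_sum => i _ /=.
  case: ifP => // /(subsetP SB); rewrite inE subn1 leq_min leqnn andbT.
  by clear; lia.
pose C := [set i | 0 < b i].
have wC : w <= #|C|.
  rewrite -(leq_pmul2l (ltn0Sn k)) (leq_trans kw) // mulnC -sum_nat_const.
  rewrite [leqRHS]big_mkcond /=; apply: leq_sum => i _.
  by rewrite inE; case: posnP => [->|_]; rewrite ?min0n // geq_minr.
have BC : B \subset C.
  by apply/subsetP => i; rewrite !inE; apply: leq_ltn_trans.
have wBC : w - #|B| <= #|C :\: B|.
  by rewrite cardsD (finset.setIidPr BC) leq_sub2r.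
have [D DCB Dw] := subset_of_card wBC.
have BD : B :&: D = set0.
  apply/setP => i; rewrite in_setI in_set0; apply/negbTE/negP => /andP[iB].
  by move=> /(subsetP DCB); rewrite inE iB.
exists (B :|: D); split.
- by rewrite finset.cardsU BD cards0 subn0 Dw subnKC // ltnW.
- move=> i; rewrite inE => /orP[/(subsetP BC)|/(subsetP DCB)]; rewrite !inE //.
  by move=> /andP[].
set S := B :|: D.
(* All colours with more than k copies are in S, so lowering the truncation costs exactly one per
   element of S. *)
have Sw : \sum_i (i \in S) = w.
  rewrite -big_mkcond sum1_card /S finset.cardsU BD cards0 subn0 Dw subnKC //.
  exact: ltnW.
rewrite -(leq_add2r w) [leqLHS]addnC -mulSn (leq_trans kw) // -Sw.
rewrite -big_split /=; apply: leq_sum => i _.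
have [iS|] := boolP (i \in S); first by clear; lia.
by rewrite /S !inE negb_or -leqNgt => /andP[]; clear; lia.
Qed.

(** A colour with more than r copies supplies r, and the others supply r more by hypothesis; without
    such a colour the truncation changes nothing. *)
Lemma two_colours b r :
  2 * r <= \sum_i b i -> (forall i, r + b i <= \sum_i b i) ->
  2 * r <= \sum_i minn (b i) r.
Proof.
move=> br bi; have [/existsP[i ir]|/existsPn small] := boolP [exists i, r < b i].
  have := bi i; rewrite (bigD1 i) //= addnC leq_add2l => rs.
  have := leq_min_sum [pred j | j != i] b r; rewrite /= (minn_idPr rs) => rm.
  rewrite (bigD1 i) //= mul2n -addnn leq_add //.
  by rewrite leq_min leqnn (ltnW ir).
rewrite (eq_bigr b) // => i _; apply/minn_idPl.
by have := small i; rewrite -leqNgt.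
Qed.

(** Instead of averaging over all J, take one of least sum. By exchange each entry outside it is at
    least every entry inside, so e times the outside entry is at least q. *)
Lemma sum_subset_average A J0 c e q :
  J0 \subset A -> #|J0| = e ->
  (forall J, J \subset A -> #|J| = e -> q <= \sum_(j in J) c j) ->
  #|A| * q <= e * \sum_(j in A) c j.
Proof.
move=> J0A J0e cq.
pose Q := [pred J : {set T} | (J \subset A) && (#|J| == e)].
have QJ0 : Q J0 by rewrite /= J0A J0e eqxx.
have [J /andP[JA /eqP Je] Jmin] := arg_minnP (fun J => \sum_(j in J) c j) QJ0.
have swap i j : i \in J -> j \in A :\: J -> c i <= c j.
  rewrite inE => iJ /andP[jJ jA].
  have jJi : j \notin J :\ i by rewrite inE (negPf jJ) andbF.
  have := Jmin (j |: (J :\ i)).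
  rewrite /= finset.subUset finset.sub1set jA.
  rewrite (fintype.subset_trans _ JA) ?finset.subsetDl //.
  rewrite cardsU1 jJi; have := cardsD1 i J; rewrite iJ Je => <-.
  rewrite eqxx big_setU1 //= (big_setD1 i iJ) leq_add2r; exact.
have qJ := cq J JA Je.
rewrite (big_setID J) /= (finset.setIidPr JA) mulnDr.
have -> : #|A| = e + #|A :\: J|.
  by rewrite -(cardsID J A) (finset.setIidPr JA) Je.
rewrite mulnDl leq_add ?leq_mul2l ?qJ ?orbT //.
rewrite -sum_nat_const big_distrr /=; apply: leq_sum => j jAJ.
apply: leq_trans qJ _; rewrite -Je -sum_nat_const.
by apply: leq_sum => i iJ; apply: swap.
Qed.

End Colours.

(** * The linear program for the degrees of the monomials *)

Section Degrees.
Local Open Scope nat_scope.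
Variables (I : finType) (Y : {set I}) (e : nat).
Implicit Types (c : {ffun I -> nat}) (J : {set I}).
Local Notation N := #|Y|.
Local Notation u := #|~: Y|.
Hypothesis eu : e <= u.

Lemma sum_setUC c J : J \subset ~: Y ->
  \sum_(b in Y :|: J) c b = \sum_(b in Y) c b + \sum_(b in J) c b.
Proof.
move=> JY; rewrite (big_setID Y) /= finset.setUK.
rewrite finset.setDUl finset.setDv finset.set0U (setDidPl _) //.
by rewrite disjoints_subset.
Qed.

Lemma sum_setC c :
  \sum_b c b = \sum_(b in Y) c b + \sum_(b in ~: Y) c b.
Proof.
rewrite (bigID (mem Y)) /=; congr (_ + _).
by apply: eq_bigl => b; rewrite inE.
Qed.

(** Weak duality: the averaged star condition is taken with weight 1, and the sum of the N point
    conditions with weight u - e. *)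
Lemma union_monomial_degree m c :
  union_monomial Y e m c ->
  (N * (u - e) + u) * m <= (N * (u - e) + e) * \sum_b c b.
Proof.
move=> [cJ cY].
have [J0 J0Y J0e] := subset_of_card eu.
set t := \sum_b c b; set a := \sum_(b in Y) c b.
set s := \sum_(b in ~: Y) c b.
have tE : t = a + s by apply: sum_setC.
have us : u * (m - a) <= e * s.
  apply: sum_subset_average J0Y J0e _ => J JY Je.
  by rewrite leq_subLR -sum_setUC //; apply: cJ.
have Nt : N * m + a <= N * t.
  rewrite -!sum_nat_const /a -big_split /=; apply: leq_sum => y yY.
  exact: cY.
have ue : u = (u - e) + e by rewrite subnK.
move: us Nt ue; rewrite tE; move: (u - e) => v us Nt ue; rewrite ue in us *.
by move: us Nt; clear; nia.
Qed.

Lemma union_monomial_le l m c :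
  l <= m -> union_monomial Y e m c -> union_monomial Y e l c.
Proof.
move=> lm [cJ cY]; split=> [J JY Je|y yY]; first exact: leq_trans (cJ J JY Je).
by apply: leq_trans (cY y yY); rewrite leq_add2r.
Qed.

(** The optimal solution has weight u - e on each y and 1 on each star form: all conditions become
    equalities. *)
Lemma union_monomial_exists k :
  exists2 c : {ffun I -> nat},
    union_monomial Y e (k * (N * (u - e) + e)) c &
    \sum_b c b = k * (N * (u - e) + u).
Proof.
pose c := [ffun b => if b \in Y then k * (u - e) else k].
have cY : \sum_(b in Y) c b = N * (k * (u - e)).
  by rewrite -sum_nat_const; apply: eq_bigr => b bY; rewrite ffunE bY.
have cJ J : J \subset ~: Y -> \sum_(b in J) c b = #|J| * k.
  move=> JY; rewrite -sum_nat_const; apply: eq_bigr => b /(subsetP JY).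
  by rewrite inE ffunE => /negPf->.
have ct : \sum_b c b = k * (N * (u - e) + u).
  by rewrite sum_setC cY cJ //; clear; lia.
exists c => //; split=> [J JY Je|y yY].
  by rewrite sum_setUC // cY cJ // Je; clear; lia.
rewrite ct ffunE yY -mulnDr leq_mul2l -addnA subnKC ?leqnn ?orbT //.
Qed.

End Degrees.

(** * Monomials of the symbolic power in ordinary powers, for e = n *)

Section Containment.
Variables (K : fieldType) (d : nat) (I : finType) (F : I -> 'cV[K]_d).
Variables (Y : {set I}) (n : nat) (A : {mpoly K[d]} -> Prop).
Implicit Types (f : {mpoly K[d]}) (S T J : {set I}) (c : {ffun I -> nat}).
Hypothesis cardL : (n < #|~: Y|)%N.
Hypothesis AP : forall c, union_monomial Y n 1 c -> A (fmon F c).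
Hypothesis relation : forall T b,
  T \subset ~: Y -> #|T| = n.+1 -> b \notin Y ->
  exists k : I -> K, linform (F b) = \sum_(j in T) k j *: linform (F j).

Local Notation mon := (fmon F).
Local Notation w := (#|~: Y| - n + 1)%N.

Definition decr S c : {ffun I -> nat} := [ffun b => (c b - (b \in S))%N].

Lemma sum_decr (P : pred I) S c : (forall b, b \in S -> (0 < c b)%N) ->
  (\sum_(b | P b) c b =
   \sum_(b | P b) decr S c b + \sum_(b | P b) (b \in S))%N.
Proof.
move=> cS; rewrite -big_split /=; apply: eq_bigr => b _; rewrite ffunE.
by have [/cS|_] := boolP (b \in S); [move: (c b); clear; lia | rewrite subn0 addn0].
Qed.

Lemma mon_decr S c : (forall b, b \in S -> (0 < c b)%N) ->
  mon c = mon [ffun b => (b \in S : nat)] * mon (decr S c).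
Proof.
move=> cS; rewrite /fmon -big_split /=; apply: eq_bigr => b _.
rewrite !ffunE -exprD; congr (_ ^+ _).
by have [/cS|_] := boolP (b \in S); [move: (c b); clear; lia | rewrite subn0].
Qed.

(** The product of the forms in S lies in A: S meets every Y :|: J and keeps an element when one y
    is left out. *)
Lemma ideal_pow_decr S c r :
  (2 <= #|S|)%N ->
  (forall J, J \subset ~: Y -> #|J| = n -> exists2 b, b \in Y :|: J & b \in S) ->
  (forall b, b \in S -> (0 < c b)%N) ->
  ideal_pow A r (mon (decr S c)) -> ideal_pow A r.+1 (mon c).
Proof.
move=> S2 SJ cS Ar; rewrite (mon_decr cS); apply: ideal_powS => //.
apply: AP; split=> [J JY Jn|y yY].
  have [b bYJ bS] := SJ J JY Jn.
  by rewrite (bigD1 b) //= ffunE bS.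
under eq_bigr do rewrite ffunE.
rewrite -big_mkcond sum1_card ffunE; case: (y \in S) => //.
exact: ltnW.
Qed.

(** All star forms share one colour, represented by j0, so a pair of distinct colours always
    contains some y. *)
Lemma ideal_pow_pairs r c :
  (2 * r <= \sum_(y in Y) minn (c y) r + minn (\sum_(b in ~: Y) c b) r)%N ->
  ideal_pow A r (mon c).
Proof.
have /card_gt0P[j0 j0Y] : (0 < #|~: Y|)%N by apply: leq_ltn_trans cardL.
have {}j0Y : j0 \notin Y by rewrite inE in j0Y.
pose b c i := if i \in Y then c i else
  if i == j0 then (\sum_(b in ~: Y) c b)%N else 0%N.
have bE (h : nat -> nat) c' : h 0%N = 0%N ->
    (\sum_i h (b c' i) =
     \sum_(y in Y) h (c' y) + h (\sum_(b in ~: Y) c' b))%N.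
  move=> h0; rewrite (bigID (mem Y)) /=; congr addn.
    by apply: eq_bigr => y yY; rewrite /b yY.
  rewrite (bigD1 j0) //= big1 => [|i /andP[iY ij]].
    by rewrite /b (negPf j0Y) eqxx addn0.
  by rewrite /b (negPf iY) (negPf ij).
elim: r c => [|r IH] c; first by move=> _; apply: ideal_pow0.
rewrite -(bE (fun k => minn k r.+1)) ?min0n // mulnC => /colour_step[S [S2 bS Sr]].
(* S' is S with j0, if present, replaced by a star form that really divides the monomial. *)
have [S' [S'2 S'Y cS' S'b]] : exists S', [/\ #|S'| = 2%N,
    exists2 y, y \in Y & y \in S', forall i, i \in S' -> (0 < c i)%N
    & forall i, (b c i - (i \in S) <= b (decr S' c) i)%N].
  have SY i : i \in S -> i != j0 -> i \in Y.
    move=> /bS; rewrite /b; case: (i \in Y) => //.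
    by move=> + /negPf ij; rewrite ij.
  have ySY : exists2 y, y \in Y & y \in S.
    have /card_gt0P[y] : (0 < #|S :\ j0|)%N.
      move: S2; rewrite (cardsD1 j0); case: #|S :\ j0| => //.
      by case: (j0 \in S).
    by rewrite in_setD1 => /andP[yj yS]; exists y => //; apply: SY.
  have [j0S|j0S] := boolP (j0 \in S); last first.
    exists S; split=> // i.
      move=> iS; have := bS i iS; rewrite /b SY //.
      by apply: contraNneq j0S => <-.
    rewrite /b ffunE; case: ifP => // iY.
    case: eqP => // ->; rewrite (negPf j0S) subn0.
    apply: eq_leq; apply: eq_bigr => k; rewrite inE ffunE => kY.
    case: (boolP (k \in S)) => [kS|]; last by rewrite subn0.
    by rewrite SY // in kY; apply: contraNneq j0S => <-.
  have [j jY cj] : exists2 j, j \in ~: Y & (0 < c j)%N.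
    have := bS j0 j0S; rewrite /b (negPf j0Y) eqxx lt0n sum_nat_eq0.
    rewrite negb_forall => /existsP[j].
    by rewrite negb_imply -lt0n => /andP[]; exists j.
  have jnY : j \notin Y by rewrite inE in jY.
  have S0Y : S :\ j0 \subset Y.
    by apply/subsetP => i; rewrite in_setD1 => /andP[ij iS]; apply: SY.
  have jS0 : j \notin S :\ j0 by apply: contraNN jnY => /(subsetP S0Y).
  have cS' i : i \in j |: (S :\ j0) -> (0 < c i)%N.
    rewrite in_setU1 => /orP[/eqP->//|iS0].
    have iY := subsetP S0Y _ iS0; have := bS i.
    by rewrite (subsetP (finset.subD1set _ _) _ iS0) /b iY; apply.
  exists (j |: (S :\ j0)); split=> //.
  - by rewrite cardsU1 jS0; move: S2; rewrite (cardsD1 j0) j0S.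
  - have [y yY yS] := ySY; exists y => //.
    rewrite in_setU1 in_setD1 yS andbT; apply/orP; right.
    by apply: contraTneq yY => ->.
  move=> i; rewrite /b; case: ifP => iY.
    rewrite ffunE in_setU1 in_setD1.
    have -> : i == j = false by apply: contraNF jnY => /eqP <-.
    by have -> : i != j0 by apply: contraNneq j0Y => <-.
  case: eqP => // ->; rewrite j0S (sum_decr (fun i => i \in ~: Y) cS').
  rewrite leq_subLR addnC leq_add2r (bigD1 j) //= setU11 big1 // => k.
  rewrite inE => /andP[kY /negPf kj]; rewrite in_setU1 kj /=.
  by case: (boolP (k \in S :\ j0)) => // /(subsetP S0Y) kY'; rewrite kY' in kY.
apply: (@ideal_pow_decr S') => //; first by rewrite S'2.
  by move=> J _ _; have [y yY yS] := S'Y; exists y => //; rewrite inE yY.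
apply: IH; rewrite mulnC -(bE (fun k => minn k r)) ?min0n // (leq_trans Sr) //.
by apply: leq_sum => i _; rewrite leq_min geq_minr andbT geq_min S'b.
Qed.

(** Each of k factors is a product of w distinct star forms; it meets every J of size n because only
    w - 1 star forms lie outside J. At least r forms from each of the two kinds remain for r
    pairs. *)
Lemma ideal_pow_peel k r c :
  (k * w <= \sum_(b in ~: Y) minn (c b) k)%N -> (r <= \sum_(y in Y) c y)%N ->
  (k * w + r <= \sum_(b in ~: Y) c b)%N -> ideal_pow A (k + r) (mon c).
Proof.
elim: k c => [|k IH] c kw rY kwr.
  apply: ideal_pow_pairs; rewrite add0n in kwr *.
  rewrite (minn_idPr kwr) mul2n -addnn leq_add2r.
  apply: leq_trans (leq_min_sum _ _ _).
  by rewrite leq_min rY leqnn.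
have [|S [Sw bS Sk]] :=
    @colour_step _ (fun i => if i \in Y then 0%N else c i) w k.
  rewrite (leq_trans kw) // big_mkcond; apply: leq_sum => i _ /=.
  by rewrite inE; case: (i \in Y).
have SY : S \subset ~: Y.
  by apply/subsetP => i iS; rewrite inE; have := bS i iS; case: (i \in Y).
have cS i : i \in S -> (0 < c i)%N.
  by move=> iS; have := bS i iS; case: (i \in Y).
have SYC y : y \in Y -> y \in S = false.
  by move=> yY; apply/negP => /(subsetP SY); rewrite inE yY.
rewrite addSn; apply: (@ideal_pow_decr S) => //.
- by rewrite Sw addn1 ltnS subn_gt0.
- move=> J JY Jn; have : ~~ (S \subset ~: Y :\: J).
    apply/negP => /subset_leq_card; rewrite Sw cardsD (finset.setIidPr JY) Jn.
    by rewrite addn1 ltnn.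
  move=> /subsetPn[b bS']; rewrite !inE negb_and !negbK => bJ.
  by exists b => //; rewrite inE orbC.
apply: IH.
- apply: leq_trans Sk _; rewrite [leqRHS]big_mkcond; apply: leq_sum => i _ /=.
  by rewrite inE ffunE; case: (i \in Y); rewrite ?sub0n ?min0n.
- rewrite (leq_trans rY) // leq_eqVlt; apply/orP; left; apply/eqP/eq_bigr.
  by move=> y yY; rewrite ffunE SYC // subn0.
- move: kwr; rewrite (sum_decr (fun b => b \in ~: Y) cS).
  have -> : (\sum_(b in ~: Y) (b \in S) = w)%N.
    rewrite -Sw -sum1_card [RHS]big_mkcond [LHS]big_mkcond; apply: eq_bigr => b _.
    rewrite inE; case: (boolP (b \in Y)) => [/SYC->//|_].
    by case: (b \in S).
  by rewrite mulSn [(w + _)%N]addnC -addnA [(w + r)%N]addnC addnA leq_add2r.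
Qed.

(* Any form of the star can be replaced by a combination of n+1 others, which
   moves its excess exponent to forms whose exponent is less than k. *)
Lemma mspan_spread k c :
  (forall J, J \subset ~: Y -> #|J| = n -> (k <= \sum_(b in J) c b)%N) ->
  (k * w <= \sum_(b in ~: Y) c b)%N ->
  mspan F (fun c' => [/\ (\sum_(b in Y) c' b = \sum_(b in Y) c b)%N,
      (\sum_(b in ~: Y) c' b = \sum_(b in ~: Y) c b)%N
    & (k * w <= \sum_(b in ~: Y) minn (c' b) k)%N]) (mon c).
Proof.
have [p] := ubnP (k * w - \sum_(b in ~: Y) minn (c b) k)%N.
elim: p c => // p IH c; rewrite ltnS => cp cJ ck.
have [kc|kc] := leqP (k * w)%N (\sum_(b in ~: Y) minn (c b) k)%N.
  exact: mspan_fmon.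
have [j0 j0Y kj0] : exists2 j, j \in ~: Y & (k < c j)%N.
  apply/exists_inP; apply: contraLR kc => /exists_inPn none.
  rewrite -leqNgt (leq_trans ck) // leq_sum // => j jY.
  by rewrite leq_min leqnn /= leqNgt none.
pose L := [set j in ~: Y | (c j < k)%N].
have LY : L \subset ~: Y by apply/subsetP => j; rewrite inE => /andP[].
(* The origin of w: otherwise some n indices include all of L. They contribute at least k in total,
   and each of the other u - n contributes k, so the truncated sum is already k w. *)
have Ln : (n < #|L|)%N.
  rewrite ltnNge; apply/negP => Ln.
  have [|D DL Dn] := @subset_of_card _ (~: Y :\: L) (n - #|L|).
    by rewrite cardsD (finset.setIidPr LY) leq_sub2r // ltnW.
  have LDY : L :|: D \subset ~: Y.
    by rewrite finset.subUset LY (fintype.subset_trans DL) // finset.subsetDl.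
  have LD : #|L :|: D| = n.
    rewrite finset.cardsU (_ : L :&: D = set0) ?cards0 ?subn0 ?Dn ?subnKC //.
    apply/setP => i; rewrite in_setI in_set0; apply/negbTE/negP => /andP[iL].
    by move=> /(subsetP DL); rewrite inE iL.
  move: kc; rewrite ltnNge => /negP[].
  rewrite (big_setID (L :|: D)) /= (finset.setIidPr LDY) mulnDr muln1 addnC.
  apply: leq_add.
    apply: leq_trans (leq_min_sum _ _ _).
    by rewrite leq_min leqnn andbT; apply: cJ.
  rewrite -LD -{1}(finset.setIidPr LDY) -cardsD mulnC -sum_nat_const.
  apply: leq_sum => i; rewrite !inE negb_or => /andP[/andP[iL _] iY].
  by rewrite leq_min leqnn andbT; move: iL; rewrite iY /= -leqNgt.
have [T TL Tn] := subset_of_card Ln.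
have TY := fintype.subset_trans TL LY.
have j0nY : j0 \notin Y by rewrite inE in j0Y.
have [a aE] := relation TY Tn j0nY.
pose c0 := decr [set j0] c.
have c0S b : b \in [set j0] -> (0 < c b)%N.
  by rewrite inE => /eqP->; apply: leq_ltn_trans kj0.
have cE : mon c = linform (F j0) * mon c0.
  rewrite (mon_decr c0S); congr (_ * _); rewrite /fmon (bigD1 j0) //= big1.
    by rewrite mulr1 ffunE inE eqxx expr1.
  by move=> i /negPf ij; rewrite ffunE inE ij expr0.
rewrite cE aE mulr_suml; set Q := (X in mspan _ X _).
elim/big_rec: _ => [|j x jT xP]; first exact: mspan0.
apply: mspanD => //; rewrite -scalerAl -fmon_incr; apply: mspanZ.
have jL := subsetP TL _ jT.
have jY : j \in ~: Y by apply: (subsetP LY).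
have jk : (c j < k)%N by move: jL; rewrite inE => /andP[].
have sum1 (J : {set I}) : (\sum_(b in J) (b \in [set j0]) = (j0 \in J))%N.
  case: (boolP (j0 \in J)) => jJ.
    rewrite (bigD1 j0) //= inE eqxx big1 // => i /andP[_ /negPf ij].
    by rewrite inE ij.
  by rewrite big1 // => i iJ; rewrite inE; case: eqP => // ij; rewrite -ij iJ in jJ.
have sumJ (J : {set I}) :
    (\sum_(b in J) incr j c0 b + (j0 \in J) = \sum_(b in J) c b + (j \in J))%N.
  rewrite sum_incr (sum_decr (fun b => b \in J) c0S) sum1.
  by rewrite addnAC.
have jj0 : j == j0 = false.
  by apply/negP => /eqP jj; move: jk; rewrite jj ltnNge ltnW.
(* The deficit drops by one: j was below k, while j0 was above k and is still at least k. *)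
have min0 : (\sum_(b in ~: Y) minn (incr j c0 b) k =
             (\sum_(b in ~: Y) minn (c b) k).+1)%N.
  rewrite (bigD1 j) //= [in RHS](bigD1 j) //= -addSn !ffunE eqxx inE jj0.
  congr addn; first by move: jk; clear; lia.
  apply: eq_bigr => b /andP[_ /negPf bj]; rewrite !ffunE bj inE.
  by case: eqP => [->|]; first move: kj0; clear; lia.
have := IH (incr j c0).
rewrite /Q.
have sY : (\sum_(b in ~: Y) incr j c0 b = \sum_(b in ~: Y) c b)%N.
  apply/eqP; rewrite -(eqn_add2r 1); apply/eqP.
  by have := sumJ (~: Y); rewrite j0Y jY.
have sY' : (\sum_(b in Y) incr j c0 b = \sum_(b in Y) c b)%N.
  have := sumJ Y; move: j0Y jY; rewrite !inE => /negPf-> /negPf->.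
  by rewrite !addn0.
rewrite sY sY' min0; apply=> //.
  by apply: leq_trans cp; move: kc; clear; lia.
move=> J JY Jn; have [j0J|j0J] := boolP (j0 \in J).
  by rewrite (bigD1 j0) //= !ffunE eq_sym jj0 inE eqxx; move: kj0; clear; lia.
have := sumJ J; rewrite (negPf j0J) addn0 => ->.
by rewrite (leq_trans (cJ J JY Jn)) // leq_addr.
Qed.

Lemma ideal_pow_union_monomial r c :
  union_monomial Y n r c -> (r * w <= \sum_b c b)%N -> ideal_pow A r (mon c).
Proof.
move=> [cJ cY]; rewrite (sum_setC Y) => rw.
have w2 : (2 <= w)%N by rewrite addn1 ltnS subn_gt0.
set a := (\sum_(b in Y) c b)%N in rw *; set s := (\sum_(b in ~: Y) c b)%N in rw *.
have [ra|ar] := leqP r a.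
  apply: ideal_pow_pairs; rewrite -/s.
  have /card_gt0P[j0 j0Y] : (0 < #|~: Y|)%N by apply: leq_ltn_trans cardL.
  have {}j0Y : j0 \notin Y by rewrite inE in j0Y.
  pose b i := if i \in Y then c i else if i == j0 then s else 0%N.
  have bE (h : nat -> nat) : h 0%N = 0%N ->
      (\sum_i h (b i) = \sum_(y in Y) h (c y) + h s)%N.
    move=> h0; rewrite (bigID (mem Y)) /=; congr addn.
      by apply: eq_bigr => y yY; rewrite /b yY.
    rewrite (bigD1 j0) //= big1 => [|i /andP[iY ij]].
      by rewrite /b (negPf j0Y) eqxx addn0.
    by rewrite /b (negPf iY) (negPf ij).
  have rt : (2 * r <= a + s)%N.
    by rewrite mulnC (leq_trans _ rw) // leq_mul2l w2 orbT.
  rewrite -(bE (fun k => minn k r)) ?min0n //.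
  apply: two_colours; rewrite (bE id) // => i.
  rewrite /b; case: ifP => iY; first by have := cY i iY; rewrite (sum_setC Y).
  case: ifP => _; first by rewrite leq_add2r.
  by rewrite addn0 (leq_trans _ rt) // leq_pmull.
(* The a forms from Y yield only a pairs, so k factors must consist of star forms. Since w >= 2, the
   degree bound leaves a star forms for the pairs. *)
pose k := (r - a)%N; have rE : r = (k + a)%N by rewrite subnK // ltnW.
have kJ J : J \subset ~: Y -> #|J| = n -> (k <= \sum_(b in J) c b)%N.
  by move=> JY Jn; rewrite leq_subLR -sum_setUC //; apply: cJ.
have kwa : (k * w + a <= s)%N.
  move: rw; rewrite rE mulnDl => rw.
  have : (2 * a <= a * w)%N by rewrite mulnC leq_mul2l w2 orbT.
  by move: rw; clear; lia.
have [|l lP ->] := mspan_spread kJ.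
  by rewrite (leq_trans _ kwa) // leq_addr.
have : forall x, x \in l -> ideal_pow A r (mon x.2).
  move=> x /lP[xY xs xk]; rewrite rE.
  by apply: ideal_pow_peel; rewrite ?xY ?xs.
elim: (l) => [|x l' IH] lA; first by rewrite big_nil; apply: ideal_gen0.
rewrite big_cons; apply: ideal_genD; last first.
  by apply: IH => y yl; apply: lA; rewrite in_cons yl orbT.
by rewrite -mul_mpolyC; apply/ideal_genMl/lA; rewrite mem_head.
Qed.

End Containment.

(** * Equations of subspaces *)

Section Subspaces.
Variables (K : fieldType) (d : nat).
Implicit Types (V W : {vspace 'rV[K]_d}) (w : 'rV[K]_d).

Definition vmatrix V : 'M[K]_(\dim V, d) := \matrix_(i < \dim V) (vbasis V)`_i.

Lemma mem_vmatrix V w : (w \in V) = (w <= vmatrix V)%MS.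
Proof.
apply/idP/submxP => [/coord_vbasis->|[a ->]].
  exists (\row_i coord (vbasis V) i w); rewrite mulmx_sum_row.
  by apply: eq_bigr => i _; rewrite mxE rowK.
rewrite mulmx_sum_row; apply: rpred_sum => i _; apply: rpredZ; rewrite rowK.
by apply/vbasis_mem/mem_nth; rewrite size_tuple.
Qed.

Lemma rank_vmatrix V : \rank (vmatrix V) = \dim V.
Proof.
apply/eqP/inj_row_free => v vV0; apply/rowP => i; rewrite mxE.
have /freeP/(_ (fun i => v 0 i)) := basis_free (vbasisP V); apply.
rewrite -[RHS]vV0 mulmx_sum_row; apply: eq_bigr => j _.
by rewrite rowK.
Qed.

(** The left inverse P is a tuple of points independent modulo W, which shows later that the open
    set is nonempty. *)
Lemma subspace_equations W N : (\dim W + N = d)%N ->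
  exists C : 'M[K]_(d, N),
    (forall w, w \in W <-> w *m C = 0) /\ exists P : 'M[K]_(N, d), P *m C = 1%:M.
Proof.
move=> WN; pose A := cokermx (vmatrix W).
have rA : \rank A = N by rewrite mxrank_coker rank_vmatrix; move: WN; clear; lia.
rewrite -rA; exists (col_base A); split=> [w|].
  rewrite mem_vmatrix submxE -/A -{1}(mulmx_base A) mulmxA.
  rewrite mulmx_free_eq0 ?row_base_free //; split=> [/eqP//|->].
  exact: eqxx.
exists (pinvmx (col_base A)); apply: mulVpmx; exact: col_base_full.
Qed.

(** V and P impose fewer than d conditions, so a nonzero solution exists. If it killed a vector of W
    outside V, it would kill W and P, hence everything. *)
Lemma hyperplane_form V W N (P : 'M[K]_(N, d)) :
  (V <= W)%VS -> (\dim V).+1 = \dim W -> (\dim W + N = d)%N ->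
  (forall x : 'rV[K]_d, exists2 w, w \in W & exists a, x = w + a *m P) ->
  exists a : 'cV[K]_d, P *m a = 0 /\
    forall w, w \in W -> (w *m a = 0 <-> w \in V).
Proof.
move=> VW dV dW WP.
pose M := col_mx (vmatrix V) P.
have /rowV0Pn[b bM b0] : kermx M^T != 0.
  rewrite kermx_eq0 -row_leq_rank mxrank_tr -ltnNge.
  apply: leq_ltn_trans (rank_leq_row _) _; move: dV dW; clear; lia.
have Mb : M *m b^T = 0.
  by apply: trmx_inj; rewrite trmx_mul trmxK trmx0; apply/sub_kermxP.
have [Vb Pb] : vmatrix V *m b^T = 0 /\ P *m b^T = 0.
  by apply/eq_col_mx; rewrite -mul_col_mx Mb col_mx0.
exists b^T; split=> // w wW; split=> [wb|]; last first.
  by rewrite mem_vmatrix => /submxP[a ->]; rewrite -mulmxA Vb mulmx0.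
apply: contraTT isT => wV; case/eqP: b0; apply: trmx_inj; rewrite trmx0.
have VwW : (V + <[w]> == W)%VS.
  have sub : (V + <[w]> <= W)%VS by rewrite subv_add VW -memvE.
  rewrite -(dimv_leqif_eq sub) eqn_leq (dimv_leqif_eq sub) -dV.
  rewrite -(dimv_leqif_eq (addvSl V <[w]>)) /= ltn_neqAle.
  rewrite (dimv_leqif_eq (addvSl V <[w]>)) andbT.
  rewrite (dimv_leqif_eq (addvSl V <[w]>)).
  apply: contra wV => /eqP->; rewrite memvE addvSr //.
apply/matrixP => i j; rewrite ord1 [RHS]mxE.
have [z zW [a iE]] := WP (delta_mx 0 i).
have zb : z *m b^T = 0.
  move: zW; rewrite -(eqP VwW) => /memv_addP[z1 z1V [_ /vlineP[k ->] ->]].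
  rewrite mulmxDl -scalemxAl wb scaler0 addr0.
  by move: z1V; rewrite mem_vmatrix => /submxP[a' ->]; rewrite -mulmxA Vb mulmx0.
have : delta_mx 0 i *m b^T = 0 :> 'M_1.
  by rewrite iE mulmxDl zb -mulmxA Pb mulmx0 addr0.
by rewrite -rowE => /matrixP/(_ 0 0); rewrite !mxE.
Qed.

End Subspaces.

(** * The linear forms attached to the points and the star *)

Section StarGeometry.
Variables (K : fieldType) (n N u e : nat).
Local Notation d := (n + N).+1.
Variables (W : {vspace 'rV[K]_d}) (H : 'I_u -> {vspace 'rV[K]_d}).
Variables (P : 'M[K]_(N, d)) (C : 'M[K]_(d, N)).
Hypothesis e0 : (0 < e)%N.
Hypothesis dimW : \dim W = n.+1.
Hypothesis starH : star_hyperplanes n W H.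
Hypothesis CW : forall w, w \in W <-> w *m C = 0.
Hypothesis PC : P *m C \in unitmx.

Lemma split_complement (x : 'rV[K]_d) :
  exists2 w, w \in W & exists a, x = w + a *m P.
Proof.
exists (x - x *m C *m invmx (P *m C) *m P).
  by apply/CW; rewrite mulmxBl -[X in _ - X]mulmxA mulmxKV ?subrr.
by exists (x *m C *m invmx (P *m C)); rewrite subrK.
Qed.

Lemma dim_cap_hyperplanes (s : seq 'I_u) :
  (n.+1 - size s <= \dim (W :&: \bigcap_(j <- s) H j))%N.
Proof.
elim: s => [|j s IH]; first by rewrite big_nil capvf dimW subn0.
rewrite big_cons capvA (capvC W) -capvA; set V := (W :&: _)%VS in IH *.
have [HW dH] := starH.1 j.
have := dimv_sum_cap (H j) V.
have : (\dim (H j + V) <= n.+1)%N.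
  by rewrite -dimW dimvS // subv_add HW capvSl.
rewrite dH /=; move: IH; clear; lia.
Qed.

(** Without H j the intersection has dimension above the bound that [star_hyperplanes] sets for all
    of J; the assumption on the size of J keeps the truncated subtraction exact. *)
Lemma star_separating_vector (J : {set 'I_u}) j :
  (#|J| <= n.+1)%N -> j \in J ->
  exists2 w, w \in W & w \notin H j /\ forall i, i \in J -> i != j -> w \in H i.
Proof.
move=> Jn jJ; pose V := (W :&: \bigcap_(i in J :\ j) H i)%VS.
have dV : (n.+1 - #|J :\ j| <= \dim V)%N.
  have := dim_cap_hyperplanes (enum (J :\ j)).
  by rewrite -cardE big_enum.
have : ~~ (V <= H j)%VS.
  apply/negP => VH.
  have J0 : J != set0 by apply/set0Pn; exists j.
  have := starH.2 J J0; apply/negP; rewrite -ltnNge.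
  have VJ : (V <= \bigcap_(i in J) H i)%VS.
    apply/subv_bigcapP => i iJ; have [->//|ij] := eqVneq i j.
    apply: subv_trans (capvSr _ _) _; apply: (bigcapv_inf i) => //.
    by rewrite in_setD1 ij.
  apply: leq_trans (dimvS VJ); apply: leq_trans dV.
  by move: Jn; rewrite (cardsD1 j J) jJ; clear; lia.
move=> /subvPn[w wV wj]; move: wV; rewrite memv_cap => /andP[wW wC].
exists w => //; split=> // i iJ ij; apply: (subvP _ _ wC).
by apply: (bigcapv_inf i) => //; rewrite in_setD1 ij.
Qed.

Local Notation I := ('I_N + 'I_u)%type.
Definition point_indices : {set I} := [set b | if b is inl _ then true else false].
Local Notation Y := point_indices.

Definition star_point (b : I) : 'rV[K]_d := if b is inl i then row i P else 0.

Definition star_space (J : {set I}) : {vspace 'rV[K]_d} :=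
  (\bigcap_(j | inr j \in J) H j)%VS.

Lemma star_configuration_forms : exists F : I -> 'cV[K]_d,
  [/\ forall (B : {set I}) b, (#|B :\: Y| <= n.+1)%N -> b \in B ->
        exists w, dual_vector F B b w,
      forall y, y \in Y -> dual_vector F [set: I] y (star_point y)
    & forall (J : {set I}) v, J \subset ~: Y -> #|J| = e ->
        (v \in star_space J <-> forall b, b \in Y :|: J -> v *m F b = 0)].
Proof.
(* This normalises the equations of W: the columns of D are the y_i, and they are dual to the
   points. *)
pose D := C *m invmx (P *m C).
have PD : P *m D = 1%:M by rewrite mulmxA mulmxV.
have DW w : w \in W <-> w *m D = 0.
  rewrite CW mulmxA; split=> [->|wD]; first by rewrite mul0mx.
  by rewrite -[w *m C](mulmxKV PC) wD mul0mx.
have [l lP] : exists l : 'I_u -> 'cV[K]_d, forall j, P *m l j = 0 /\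
    forall w, w \in W -> (w *m l j = 0 <-> w \in H j).
  apply: (@fin_all_exists _ _ (fun j a => P *m a = 0 /\
    forall w, w \in W -> (w *m a = 0 <-> w \in H j))) => j.
  have [HW dH] := starH.1 j.
  apply: hyperplane_form HW _ _ split_complement; first by rewrite dH dimW.
  by rewrite dimW.
pose F (b : I) := match b with inl i => col i D | inr j => l j end.
have FW w i : w \in W -> w *m F (inl i) = 0.
  by move=> /DW wD; rewrite /F colE mulmxA wD mul0mx.
have ptF i b : row i P *m F b = if b == inl i then 1%:M else 0.
  case: b => j /=; last by rewrite -row_mul (lP j).1 row0.
  rewrite -row_mul colE mulmxA PD mul1mx; apply/matrixP => a b.
  rewrite !ord1 -[inl j == inl i]/(j == i) eq_sym.
  by case: eqP => [->|/eqP/negPf ij]; rewrite !mxE ?eqxx //= ?ij.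
have inY (b : I) : (b \in Y) = if b is inl _ then true else false by rewrite inE.
exists F; split.
- move=> B [i|j] Bn bB.
    exists (row i P); split=> [|b _ /negPf bi]; rewrite ptF ?bi ?eqxx //.
  pose J := [set j | inr j \in B].
  have [||w wW [wj wJ]] := @star_separating_vector J j; last 2 first.
  + by rewrite inE.
  + have wl : w *m l j != 0 by apply: contra wj => /eqP/(lP j).2 => /(_ wW).
    have wl0 : (w *m l j) 0 0 != 0.
      apply: contraNneq wl => w0; apply/eqP/matrixP => a b.
      by rewrite !ord1 w0 mxE.
    exists (((w *m l j) 0 0)^-1 *: w); split.
      rewrite -scalemxAl /F; apply/matrixP => a b.
      by rewrite !ord1 mxE mulVf // mxE.
    move=> [i|i] iB ij; rewrite -scalemxAl; first by rewrite FW // scaler0.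
    rewrite /F ((lP i).2 w wW).2 ?scaler0 //; apply: wJ; first by rewrite inE.
    by apply: contraNneq ij => ->.
  + apply: leq_trans Bn; rewrite -(card_imset (mem J) (@inr_inj 'I_N 'I_u)).
    apply: subset_leq_card; apply/subsetP => _ /imsetP[k kJ ->].
    by rewrite inE inY /=; rewrite inE in kJ.
- move=> [i _|j]; last by rewrite inY.
  split=> [|b _ /negPf bi]; rewrite /star_point ptF ?bi ?eqxx //.
move=> J v JY Je.
(* As e > 0, some hyperplane takes part in the intersection and puts v into W; an empty intersection
   would be the full space. *)
have /card_gt0P[[i|j0] j0J] : (0 < #|J|)%N by rewrite Je.
  by have := subsetP JY _ j0J; rewrite inE inY.
split=> [vJ b|vJ].
  have vH j : inr j \in J -> v \in H j.
    move=> jJ; rewrite memvE; apply: subv_trans vJ _.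
    exact: (bigcapv_inf j).
  have vW : v \in W by apply: (subvP (starH.1 j0).1); apply: vH.
  rewrite inE => /orP[|]; first by rewrite inY; case: b => // i _; apply: FW.
  case: b => [i|j] bJ; first by apply: FW.
  exact/((lP j).2 v vW).2/vH.
have vW : v \in W.
  apply/DW/rowP => i; rewrite [RHS]mxE.
  have := vJ (inl i); rewrite inE inY /= => /(_ isT).
  by rewrite colE mulmxA -colE => /matrixP/(_ 0 0); rewrite !mxE.
rewrite memvE; apply/subv_bigcapP => j jJ; rewrite -memvE.
by apply/((lP j).2 v vW).1/(vJ (inr j)); rewrite inE jJ orbT.
Qed.

Lemma points_and_starE V : points_and_star e P H V <->
  (exists2 y, y \in Y & V = <[star_point y]>%VS) \/
  (exists J : {set I}, [/\ J \subset ~: Y, #|J| = e & V = star_space J]).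
Proof.
have inrK (J : {set I}) : J \subset ~: Y ->
    J = [set (inr j : I) | j in [set j | inr j \in J]].
  move=> JY; apply/setP => b; apply/idP/imsetP => [bJ|[j + ->]]; last first.
    by rewrite inE.
  have := subsetP JY b bJ; rewrite !inE; case: b bJ => // j jJ _.
  by exists j => //; rewrite inE.
split=> [[[i ->]|[J [Je ->]]]|[[y yY ->]|[J [JY Je ->]]]].
- by left; exists (inl i); rewrite ?inE.
- right; exists [set (inr j : I) | j in J]; split.
  + by apply/subsetP => _ /imsetP[j _ ->]; rewrite !inE.
  + by rewrite card_imset //; apply: inr_inj.
  + by apply: eq_bigl => j; rewrite (mem_imset _ _ (@inr_inj 'I_N 'I_u)).
- by move: yY; rewrite inE; case: y => // i _; left; exists i.
- right; exists [set j | inr j \in J]; split.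
    by rewrite -Je {2}(inrK J JY) card_imset //; apply: inr_inj.
  by apply: eq_bigl => j; rewrite inE.
Qed.

Lemma card_star_points : (#|Y| = N)%N /\ #|~: Y| = u.
Proof.
have cY : #|Y| = N.
  have -> : Y = [set (inl i : I) | i in [set: 'I_N]].
    apply/setP => b; rewrite inE; apply/idP/imsetP => [|[i _ ->//]].
    by case: b => // i _; exists i; rewrite ?inE.
  by rewrite card_imset ?cardsT ?card_ord //; apply: inl_inj.
split=> //; apply/eqP; rewrite -(eqn_add2l #|Y|) cardsC cY card_sum !card_ord.
exact: eqxx.
Qed.

End StarGeometry.

(** * The open set of admissible points *)

Section GeneralPosition.
Variables (K : fieldType) (N d : nat).

(** With the degrees fixed, the condition is stable under sums, unlike [multihomogeneous]. *)
Definition multidegree (D : 'I_N -> nat) (F : {mpoly K[N * d]}) : Prop :=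
  forall m, m \in msupp F -> forall i, (\sum_(j < d) m (mxvec_index i j))%N = D i.

Lemma multidegree0 D : multidegree D 0.
Proof. by move=> m; rewrite msupp0. Qed.

Lemma multidegreeD D F1 F2 :
  multidegree D F1 -> multidegree D F2 -> multidegree D (F1 + F2).
Proof.
by move=> D1 D2 m /msuppD_le; rewrite mem_cat => /orP[/D1|/D2].
Qed.

Lemma multidegreeZ D k F : multidegree D F -> multidegree D (k *: F).
Proof. by move=> DF m /msuppZ_le/DF. Qed.

Lemma multidegree_prod (s : seq 'I_N) (D : 'I_N -> 'I_N -> nat)
    (F : 'I_N -> {mpoly K[N * d]}) :
  (forall i, multidegree (D i) (F i)) ->
  multidegree (fun k => \sum_(i <- s) D i k)%N (\prod_(i <- s) F i).
Proof.
move=> DF; elim: s => [|i s IH].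
  rewrite big_nil => m; rewrite msupp1 inE => /eqP-> i.
  by rewrite big_nil big1 // => j _; rewrite mnm0E.
rewrite big_cons => m /msuppM_le/allpairsP[[m1 m2] /= [m1F m2F ->]] k.
rewrite big_cons -(DF i _ m1F k) -(IH _ m2F k) -big_split /=.
by apply: eq_bigr => j _; rewrite mnmDE.
Qed.

Lemma eq_mxvec_index (i k : 'I_N) (j l : 'I_d) :
  (mxvec_index i j == mxvec_index k l) = (i == k) && (j == l).
Proof.
have := mxvecE (delta_mx k l : 'M[K]_(N, d)) i j.
rewrite mxvec_delta !mxE eqxx /=.
by case: (_ == _); case: (_ && _) => // /eqP; rewrite ?oner_eq0 // eq_sym oner_eq0.
Qed.

(** If the columns of C are independent equations of W, this is nonzero exactly at the tuples
    spanning a complement of W. *)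
Definition det_form (C : 'M[K]_(d, N)) : {mpoly K[N * d]} :=
  \det (\matrix_(i, k) \sum_j C j k *: 'X_(mxvec_index i j)).

Lemma det_form_multihomogeneous C : multihomogeneous (det_form C).
Proof.
exists (fun=> 1%N); apply: (_ : multidegree _ _).
rewrite /det_form /determinant; elim/big_rec: _ => [|s x _ xP].
  exact: multidegree0.
apply: multidegreeD => //.
pose a i := \sum_j C j (s i) *: 'X_(mxvec_index i j) : {mpoly K[N * d]}.
suff aP : multidegree (fun=> 1%N) (\prod_i a i).
  rewrite mulr_sign (eq_bigr a) => [|i _]; last by rewrite mxE.
  by case: ifP => // _; rewrite -scaleN1r; apply: multidegreeZ.
have aD i : multidegree (fun k => (i == k : nat)) (a i).
  rewrite /a; elim/big_rec: _ => [|j y _ yP]; first exact: multidegree0.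
  apply: multidegreeD => //; apply: multidegreeZ => m.
  rewrite msuppX inE => /eqP-> k; under eq_bigr do rewrite mnm1E eq_mxvec_index.
  rewrite (bigD1 j) //= eqxx andbT big1 ?addn0 // => l /negPf jl.
  by rewrite [j == l]eq_sym jl andbF.
move=> m /(multidegree_prod aD) mD k; rewrite mD.
by rewrite (bigD1 k) //= eqxx big1 // => i /negPf->.
Qed.

Lemma eval_det_form C P : eval_tuple (det_form C) P = \det (P *m C).
Proof.
rewrite /eval_tuple /det_form -det_map_mx; congr (\det _).
apply/matrixP => i k; rewrite !mxE raddf_sum; apply: eq_bigr => j _ /=.
by rewrite mevalZ mevalXU mxvecE mulrC.
Qed.

Lemma general_position (C : 'M[K]_(d, N)) (Q : 'M[K]_(N, d) -> Prop) :
  (exists P, P *m C = 1%:M) ->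
  (forall P, P *m C \in unitmx -> Q P) -> for_general_points Q.
Proof.
move=> [P0 P0C] CQ.
exists (fun P => exists F, F = det_form C /\ eval_tuple F P != 0); split.
- exists (fun F => F = det_form C); split=> // F ->.
  exact: det_form_multihomogeneous.
- exists P0; split.
    move=> i; apply: contraTneq isT => Pi.
    have := congr1 (row i) P0C; rewrite row_mul Pi mul0mx => /rowP/(_ i).
    by rewrite !mxE eqxx => /eqP; rewrite eq_sym oner_eq0.
  by exists (det_form C); rewrite eval_det_form P0C det1 oner_eq0.
by move=> P _ [F [->]]; rewrite eval_det_form -unitfE -unitmxE; apply: CQ.
Qed.

End GeneralPosition.

(** * Lowest degrees in ideals and their powers *)

Section LowDegree.
Variables (K : fieldType) (d : nat).
Implicit Types (f g : {mpoly K[d]}) (A : {mpoly K[d]} -> Prop).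

(** Membership in the k-th power of the irrelevant ideal. *)
Definition mindeg k f : Prop := forall m, m \in msupp f -> (k <= mdeg m)%N.

Lemma mindeg_sum (T : eqType) (s : seq T) k (f : T -> {mpoly K[d]}) :
  (forall t, t \in s -> mindeg k (f t)) -> mindeg k (\sum_(t <- s) f t).
Proof.
elim: s => [|t s IH] sf; first by rewrite big_nil => m; rewrite msupp0.
rewrite big_cons => m /msuppD_le; rewrite mem_cat => /orP[].
  by apply: sf; rewrite mem_head.
by apply: IH => t' ts; apply: sf; rewrite in_cons ts orbT.
Qed.

Lemma mindegM k l f g : mindeg k f -> mindeg l g -> mindeg (k + l) (f * g).
Proof.
move=> fk gl m /msuppM_le/allpairsP[[m1 m2] /= [m1f m2g ->]].
by rewrite mdegD leq_add // ?fk ?gl.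
Qed.

Lemma mindeg_ideal_pow A k r f :
  (forall g, A g -> mindeg k g) -> ideal_pow A r f -> mindeg (k * r) f.
Proof.
move=> Ak; move: f; apply: ideal_pow_ind => [m|f g fk gk m|a h hA].
- by rewrite msupp0.
- by move=> /msuppD_le; rewrite mem_cat => /orP[/fk|/gk].
rewrite -[(k * r)%N]add0n; apply: mindegM => //.
rewrite mulnC -[r in (r * k)%N](card_ord r) -sum_nat_const.
apply: (big_ind2 (fun l f => mindeg l f)) => [//|k1 f1 k2 f2|i _].
  exact: mindegM.
exact/Ak/hA.
Qed.

Lemma homog_mindeg t f : f \is t.-homog -> mindeg t f.
Proof. by move=> /dhomogP ft m /ft<-. Qed.

Lemma mindeg_homog k t f : mindeg k f -> f \is t.-homog -> f != 0 -> (k <= t)%N.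
Proof.
move=> fk /dhomogP ft f0; rewrite -(ft _ (mlead_supp f0)).
exact/fk/mlead_supp.
Qed.

(** The existence of a form rules out the default value 0 of [xget] in [alpha]. *)
Lemma alphaP A t : has_form_of_degree A t ->
  has_form_of_degree A (alpha A) /\ (alpha A <= t)%N.
Proof.
move=> At; pose B k := `[< has_form_of_degree A k >].
have exB : exists k, B k by exists t; apply/asboolP.
have [k /asboolP Ak kmin] := ex_minnP exB.
rewrite /alpha; case: xgetP => [l _ [Al lmin]|/(_ k)[]].
  by split=> //; apply: lmin.
by split=> // s As; apply/kmin/asboolP.
Qed.

End LowDegree.

(** * Waldschmidt constant and resurgence from degree bounds *)

Section Asymptotics.
Local Open Scope classical_set_scope.
Variables (R : realType) (K : fieldType) (d : nat).
Variables (G : {vspace 'rV[K]_d} -> Prop) (T M : nat).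
Hypothesis M0 : (0 < M)%N.
Hypothesis MT : (M < T)%N.
Hypothesis degree_ge : forall m f t, symbolic_power G m f -> f != 0 ->
  f \is t.-homog -> (T * m <= M * t)%N.
Hypothesis form_exists : forall k m, (m <= k * M)%N ->
  has_form_of_degree (symbolic_power G m) (k * T).

Let MR : (0 : R) < M%:R.
Proof. by rewrite ltr0n. Qed.

(** Rounding m up to a multiple of M puts alpha between T m / M and T (m + M) / M, so the quotient
    by m is within T / m of T / M. *)
Lemma waldschmidt_eq : waldschmidt R G = T%:R / M%:R.
Proof.
apply: cvg_lim => //; apply/cvgrPdist_le => eps eps0.
near=> m; have m0 : (0 < m)%N by near: m; apply: nbhs_infty_gt.
have mR : (0 : R) < m%:R by rewrite ltr0n.
have mT : T%:R / eps <= m%:R :> R by near: m; apply: nbhs_infty_ger.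
have [k kM km] : exists2 k, (m <= k * M)%N & (k * M <= m + M)%N.
  exists (m %/ M).+1; first by rewrite ltnW // ltn_ceil.
  by rewrite mulSn addnC leq_add2r leq_trunc_div.
have [[f [fm f0 fa]] ak] := alphaP (form_exists kM).
have := degree_ge fm f0 fa; set a := alpha _ in ak fa *.
move=> lo; have hi : (M * a <= T * m + T * M)%N.
  rewrite -mulnDr (leq_trans (leq_mul (leqnn M) ak)) // mulnA mulnC.
  by rewrite [(M * k)%N]mulnC leq_mul2l km orbT.
have loR : T%:R * m%:R <= M%:R * a%:R :> R by rewrite -!natrM ler_nat.
have hiR : M%:R * a%:R <= T%:R * m%:R + T%:R * M%:R :> R.
  by rewrite -!natrM -natrD ler_nat.
rewrite distrC ger0_norm ?subr_ge0.
  rewrite lerBlDr ler_pdivrMr // -(ler_pM2l MR).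
  have -> : M%:R * ((eps + T%:R / M%:R) * m%:R) =
      M%:R * eps * m%:R + T%:R * m%:R :> R.
    by field; rewrite gt_eqF.
  apply: le_trans hiR _; rewrite addrC lerD2r -mulrA [leRHS]mulrC ler_pM2r //.
  by rewrite mulrC -ler_pdivrMr.
by rewrite ler_pdivlMr // mulrAC ler_pdivrMr // [leRHS]mulrC.
Unshelve. all: by end_near.
Qed.

(** The symbolic power of order 2jM has a form of degree 2jT, while the ordinary power of exponent
    jT + 1 starts in degree at least 2jT + 2. The ratios 2jM / (jT + 1) tend to 2M / T. *)
Lemma union_ideal_mindeg :
  (forall f, union_ideal G f -> mindeg 2 f) ->
  ((2 / waldschmidt R G)%:E <= resurgence R G)%E.
Proof.
move=> G2; rewrite waldschmidt_eq.
have TR : (0 : R) < T%:R by rewrite ltr0n (leq_trans _ MT).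
have rho_ge j : (0 < j)%N ->
    (((2 * j * M)%:R / (j * T).+1%:R : R)%:E <= resurgence R G)%E.
  move=> j0; apply: ereal_sup_ubound.
  exists (2 * j * M)%N, (j * T).+1; split=> //; first by rewrite !muln_gt0 j0.
  have [f [fG f0 ft]] := form_exists (leqnn (2 * j * M)).
  move=> /(_ f fG) /(mindeg_ideal_pow G2) /mindeg_homog /(_ ft f0).
  by clear; lia.
rewrite leNgt; apply/negP => rho_lt.
have := rho_ge 1%N isT; case: (resurgence R G) rho_lt rho_ge => [r| |] //.
rewrite lte_fin => r_lt rho_ge _.
have gap : (0 : R) < 2 * M%:R - r * T%:R.
  by move: r_lt; rewrite invf_div mulrA ltr_pdivlMr // subr_gt0.
(* This j violates r (jT + 1) >= 2jM, which is the same as r >= j (2M - rT). *)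
pose j := (Num.bound `|r / (2 * M%:R - r * T%:R)|).+1.
have jr : r < j%:R * (2 * M%:R - r * T%:R).
  rewrite -ltr_pdivrMr //; apply: le_lt_trans (ler_norm _) _.
  by apply: lt_le_trans (archi_boundP (normr_ge0 _)) _; rewrite ler_nat.
have := rho_ge j isT; rewrite lee_fin ler_pdivrMr //.
rewrite -[(j * T).+1]addn1 natrD !natrM.
by move: jr; lra.
Qed.

Lemma resurgence_le w :
  (forall m r f, (1 <= r)%N -> (r * w * M < m * T)%N ->
     symbolic_power G m f -> ideal_pow (union_ideal G) r f) ->
  (resurgence R G <= (w%:R / waldschmidt R G)%:E)%E.
Proof.
move=> cont; rewrite waldschmidt_eq; apply: ge_ereal_sup => _ [m [r [m1 r1 nc ->]]].
have TR : (0 : R) < T%:R by rewrite ltr0n (leq_trans _ MT).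
have rR : (0 : R) < r%:R by rewrite ltr0n.
rewrite lee_fin invf_div mulrA ler_pdivrMr // mulrAC ler_pdivlMr //.
rewrite -!natrM ler_nat leqNgt; apply/negP => lt; apply: nc => f.
by apply: cont => //; move: lt; clear; nia.
Qed.

End Asymptotics.

(** * Assembly of the three assertions *)

Lemma fmon_neq0 (K : fieldType) (d : nat) (I : finType) (F : I -> 'cV[K]_d)
    (c : {ffun I -> nat}) :
  (forall b, exists w, dual_vector F [set b] b w) -> fmon F c != 0.
Proof.
move=> dualF; apply/prodf_neq0 => b _; apply: expf_neq0.
have [w /(lin_dual (idfun : {rmorphism K -> K})) wb] := dualF b.
by apply: contra_eqN wb => /eqP->; rewrite evalv0 eq_sym oner_eq0.
Qed.

Theorem theorem1p1 (R : realType) (K : fieldType) (n N e u : nat)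
    (W : {vspace 'rV[K]_(n + N).+1})
    (H : 'I_u -> {vspace 'rV[K]_(n + N).+1}) :
  (1 <= n)%N -> (1 <= N)%N -> (1 <= e <= n)%N -> (n < u)%N ->
  \dim W = n.+1 -> star_hyperplanes n W H ->
  for_general_points (fun P : 'M[K]_(N, (n + N).+1) =>
    let G := points_and_star e P H in
    let gamma : R := waldschmidt R G in
    let rho : \bar R := resurgence R G in
    [/\ ((2 / gamma)%:E <= rho)%E,
        [pchar K] =i pred0 ->
          gamma = (N * (u - e) + u)%:R / (N * (u - e) + e)%:R
      & e = n -> (rho <= ((u - n + 1)%:R / gamma)%:E)%E]).
Proof.
move=> n1 N1 /andP[e1 en] nu dimW starH.
have [C [CW PC]] : exists C : 'M[K]_((n + N).+1, N),
    (forall w, w \in W <-> w *m C = 0) /\ exists P, P *m C = 1%:M.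
  by apply: subspace_equations; rewrite dimW.
apply: (general_position PC) => P PCu G.
have [F [dualF ptP VsP]] := star_configuration_forms e1 dimW starH CW PCu.
have GE := @points_and_starE _ _ _ _ e H P.
have [cY cL] := card_star_points N u.
set Y := point_indices N u in dualF ptP VsP GE cY cL.
have cardY : (#|Y| + n.+1 = (n + N).+1)%N by rewrite cY addnC.
have cardL : (n < #|~: Y|)%N by rewrite cL.
have eu : (e <= #|~: Y|)%N by rewrite cL (leq_trans en) // ltnW.
pose T := (N * (u - e) + u)%N; pose M := (N * (u - e) + e)%N.
have M0 : (0 < M)%N by rewrite addn_gt0 e1 orbT.
have MT : (M < T)%N by rewrite ltn_add2l (leq_ltn_trans en).
have normal m f : symbolic_power G m f -> mspan F (union_monomial Y e m) f.
  exact: (symbolic_power_mspan dualF cardY cardL en ptP VsP GE).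
have symb m c : union_monomial Y e m c -> symbolic_power G m (fmon F c).
  exact: (symbolic_power_mon ptP VsP GE).
have deg m c : union_monomial Y e m c -> (T * m <= M * \sum_b c b)%N.
  by move=> /(union_monomial_degree eu); rewrite cY cL.
have degree_ge m f t : symbolic_power G m f -> f != 0 -> f \is t.-homog ->
    (T * m <= M * t)%N.
  move=> /normal fm f0 ft; have [c /deg] := mspan_homog_ne0 fm ft f0.
  by move=> + <-.
have form_exists k m : (m <= k * M)%N ->
    has_form_of_degree (symbolic_power G m) (k * T).
  have [c cP ct] := union_monomial_exists eu k; rewrite cY cL in cP ct.
  move=> mk; exists (fmon F c); split.
  - exact/symb/(union_monomial_le mk cP).
  - apply: fmon_neq0 => b; apply: dualF; last by rewrite inE.
    apply: leq_trans (subset_leq_card (finset.subsetDl _ _)) _.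
    by rewrite cards1.
  - by rewrite /T -ct; apply: fmon_homog.
have gammaE : waldschmidt R G = T%:R / M%:R.
  exact: (waldschmidt_eq _ M0 degree_ge form_exists).
split=> [|_|e_n]; first 1 last.
- exact: gammaE.
- subst e; apply: (resurgence_le _ M0 MT degree_ge form_exists) => m r f r1 rm.
  (* Allows the monomial conditions of order m to be weakened to order r. The bound on T holds
     because T - M = u - n and M >= 1. *)
  have rlem : (r <= m)%N.
    have TwM : (T <= (u - n + 1) * M)%N.
      by rewrite /T /M; move: nu N1 n1; clear; nia.
    rewrite -(leq_pmul2r (leq_ltn_trans (leq0n M) MT)) ltnW //.
    by apply: leq_ltn_trans rm; rewrite -mulnA leq_mul2l TwM orbT.
  move=> /normal[s sP ->].
  have monP c : union_monomial Y n 1 c -> union_ideal G (fmon F c).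
    exact: (union_ideal_mon ptP VsP GE).
  have rel (A : {set _}) b (AY : A \subset ~: Y) (An : #|A| = n.+1)
    (bY : b \notin Y) := lin_relation dualF cardY ptP AY An bY.
  have : forall x, x \in s -> ideal_pow (union_ideal G) r (fmon F x.2).
    move=> x /sP xP.
    apply: (ideal_pow_union_monomial cardL monP rel).
      exact: union_monomial_le xP.
    rewrite cL ltnW // -(ltn_pmul2r M0) (leq_trans rm) // mulnC.
    by rewrite [leqRHS]mulnC; apply: deg.
  elim: (s) => [|x l IH] lP; first by rewrite big_nil; apply: ideal_gen0.
  rewrite big_cons; apply: ideal_genD; last first.
    by apply: IH => y yl; apply: lP; rewrite in_cons yl orbT.
  by rewrite -mul_mpolyC; apply/ideal_genMl/lP; rewrite mem_head.
apply: (union_ideal_mindeg _ M0 MT degree_ge form_exists) => f.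
move=> /union_ideal_symbolic/normal[s sP ->]; apply: mindeg_sum => x /sP/deg.
(* For order 1 the bound reads T <= M times the degree; as M < T, the degree is at least 2. *)
rewrite muln1 => Tx m /msuppZ_le /(homog_mindeg (fmon_homog F x.2)).
apply: leq_trans; rewrite ltnNge; apply: contraL (leq_trans MT Tx) => x1.
by rewrite -leqNgt -[leqRHS]muln1 leq_mul2l x1 orbT.
Qed.
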